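(* Let $l:[0,1]\to[0,1]$ be a monotone increasing function that is slowly varying at $0$ and satisfies $\lim_{u\to0}l(u)=0$, and consider the SAMBA process with learning-rate function $$\alpha(p)=\frac{1}{p^2}\int_0^p\int_0^v l(u)\,du\,dv.$$ Then $(\mathbf p(t))_{t\in\mathbb Z_+}$ is a Markov chain, with probability $1$ we have $p_{a^\star}(t)\to1$ as $t\to\infty$, and there exists a constant $C>0$ such that for every $T\in\mathbb N$ with $C/(\Delta T)\le1$, $$\mathrm{Rg}(T)\le \frac{CN}{\Delta\, l\big(\frac{C}{\Delta T}\big)}\log T+Q+1,$$ where $Q:=\sum_{t=0}^\infty\mathbb P\big(p_{a^\star}(t)\le\frac12\big)$.
   Context: A function $l$ is slowly varying at $0$ if it is positive (on $(0,1]$ here) and $\lim_{x\to0}l(\lambda x)/l(x)=1$ for every $\lambda>0$. Bandit model: $\mathcal A$ is a finite set of arms, $N=|\mathcal A|$. For each arm $a$ and time $t\in\mathbb Z_+=\{0,1,2,\dots\}$, $R_a(t)\in\{0,1\}$ is a Bernoulli random variable with mean $r_a\in[0,1]$; all $R_a(t)$ are independent. There is a unique optimal arm $a^\star$ with $r^\star:=r_{a^\star}>r_a$ for all $a\ne a^\star$, and $\Delta:=r^\star-\max_{a\neq a^\star}r_a>0$. SAMBA process with learning-rate function $\alpha$: $\mathbf p(0)$ is a probability vector on $\mathcal A$ with all entries positive. At each time $t$, let $a_\star(t)$ be an arm maximizing $p_a(t)$ (ties broken uniformly at random) and $p_\star(t)=p_{a_\star(t)}(t)$. Exactly one arm is played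 at time $t$, arm $a$ with conditional probability $p_a(t)$ given the past (using independent randomization); $I_a(t)$ is the indicator that $a$ is played, $I_\star(t)=I_{a_\star(t)}(t)$, $R_\star(t)=R_{a_\star(t)}(t)$. For each $a\ne a_\star(t)$, $$p_a(t+1)=p_a(t)+\alpha(p_a(t))\,p_a(t)^2\Big[\frac{I_a(t)R_a(t)}{p_a(t)}-\frac{I_\star(t)R_\star(t)}{p_\star(t)}\Big],$$ and $p_{a_\star(t)}(t+1)=1-\sum_{a\ne a_\star(t)}p_a(t+1)$. Regret: $\mathrm{Rg}(T)=r^\star T-\mathbb E\big[\sum_{t=0}^{T-1}\sum_{a\in\mathcal A}I_a(t)R_a(t)\big]$. *)

(* Defs.v *)
From HB Require Import structures.
From mathcomp Require Import all_boot all_order all_algebra.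
From mathcomp Require Import all_classical all_reals all_analysis.
Set Implicit Arguments. Unset Strict Implicit. Unset Printing Implicit Defensive.
Import Order.TTheory GRing.Theory Num.Theory Num.Def.
Import numFieldNormedType.Exports.
Local Open Scope classical_set_scope.
Local Open Scope ring_scope.

Section Samba.
Variable R : realType.

Definition alpha (l : R -> R) (p : R) : R :=
  p ^- 2 * (\int[lebesgue_measure]_(v in [set v : R | 0 <= v <= p])
              (\int[lebesgue_measure]_(u in [set u : R | 0 <= u <= v]) l u)).

Definition slowly_varying_at0 (l : R -> R) : Prop :=
  (forall x, 0 < x <= 1 -> 0 < l x) /\
  forall lam : R, 0 < lam -> l (lam * x) / l x @[x --> 0^'+] --> (1 : R).

Variable A : finType.

Definition argmaxes (p : A -> R) : seq A :=
  [seq a <- enum A | [forall b, p b <= p a]].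

(* leader chosen uniformly among maximisers, using v uniform on [0,1] *)
Definition leader (dflt : A) (p : A -> R) (v : R) : A :=
  let s := argmaxes p in
  nth dflt s (minn (truncn (v * (size s)%:R)) (size s).-1).

(* arm played: the arm a whose p-interval [sum_{b<a} p b, sum_{b<=a} p b)
   (in the enumeration order of A) contains u *)
Definition played (dflt : A) (p : A -> R) (u : R) : A :=
  let s := enum A in
  nth dflt s (find (fun k => u < \sum_(b <- take k.+1 s) p b) (iota 0 (size s))).

Definition samba_new (l : R -> R) (q : A -> R) (k a : A) (rw : A -> R) (b : A) : R :=
  q b + alpha l (q b) * q b ^+ 2 *
    ((a == b)%:R * rw b / q b - (a == k)%:R * rw k / q k).

Definition samba_step (l : R -> R) (q : A -> R) (k a : A) (rw : A -> R) : A -> R :=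
  fun b => if b == k then 1 - \sum_(c | c != k) samba_new l q k a rw c
           else samba_new l q k a rw b.

Variables (d : measure_display) (Omega : measurableType d).

(* the SAMBA process, driven by rewards Rw, arm-choice uniforms U and
   tie-breaking uniforms V *)
Fixpoint samba (dflt : A) (l : R -> R) (p0 : A -> R) (Rw : A -> nat -> Omega -> R)
  (U V : nat -> Omega -> R) (t : nat) (w : Omega) : A -> R :=
  match t with
  | 0 => p0
  | t'.+1 =>
      let q := samba dflt l p0 Rw U V t' w in
      samba_step l q (leader dflt q (V t' w)) (played dflt q (U t' w))
                 (fun a => Rw a t' w)
  end.

Definition mutual_indep (P : probability Omega R) (I : eqType) (X : I -> Omega -> R) : Prop :=
  (forall i, measurable_fun setT (X i)) /\
  forall (J : seq I) (B : I -> set R), uniq J -> (forall j, measurable (B j)) ->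
    P (\bigcap_(j in [set j | j \in J]) (X j @^-1` B j)) =
    (\prod_(j <- J) P (X j @^-1` B j))%E.

Definition uniform01 (P : probability Omega R) (X : Omega -> R) : Prop :=
  forall x : R, P [set w | X w <= x] = (Num.min (Num.max x 0) 1)%:E.

Definition bernoulli_rv (P : probability Omega R) (X : Omega -> R) (m : R) : Prop :=
  (forall w, X w = 0 \/ X w = 1) /\ P [set w | X w = 1] = m%:E.

(* elementary Markov property of a process with (at each time) countably
   many values: P(p(t+1)=y | p(0)=x_0,...,p(t)=x_t) = P(p(t+1)=y | p(t)=x_t),
   written without division *)
Definition markov_chain (P : probability Omega R) (S : Type) (X : nat -> Omega -> S) : Prop :=
  forall (t : nat) (xs : nat -> S) (y : S),
    let H := \bigcap_(s in `I_t.+1) [set w | X s w = xs s] in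
    (P (H `&` [set w | X t.+1 w = y]) * P [set w | X t w = xs t] =
     P H * P ([set w | X t w = xs t] `&` [set w | X t.+1 w = y]))%E.

End Samba.

(* Main.v *)
Require Import Defs.
From HB Require Import structures.
From mathcomp Require Import all_boot all_order all_algebra.
From mathcomp Require Import all_classical all_reals all_analysis.
From mathcomp Require Import measurable_realfun.
From mathcomp Require Import ring lra.
Set Implicit Arguments. Unset Strict Implicit. Unset Printing Implicit Defensive.
Import Order.TTheory GRing.Theory Num.Theory Num.Def.
Import numFieldNormedType.Exports.
Local Open Scope classical_set_scope.
Local Open Scope ring_scope.

(* The coordinate p_astar is a submartingale: its drift is gain(p_astar) times a
   reward gap when another arm leads, and a sum of gain(p_c) times reward gaps
   when astar leads, where gain(p) = alpha(p) p^2.  Summability of the drift and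
   Borel-Cantelli push p_astar to {0, 1}; the supermartingale 1/p_astar - K
   p_astar excludes 0, and p_astar cannot jump from near 1 to near 0.

   For the regret, y_t = E[1 - p_astar(t)] is nonincreasing and dominates the
   expected regret at time t.  Convexity of gain gives
   y_t - y_{t+1} >= Delta gain(z_t / N) up to constants, with y_t - z_t
   <= P(p_astar(t) <= 1/2), a sequence of sum Q (and nothing is to be proved if
   Q is infinite).  Comparing y_n and y_{2n} yields y_n = O(1 / (n l(1/n))) along
   powers of 2, hence the sum of y_t for t < T is O(log T / l(1/T)); slow
   variation replaces 1/T by C / (Delta T).

   At time t the process is a function of finitely many letters, so
   expectations are finite sums over words, and the one-step law of the letters
   is read off directly from the independence of the sources. *)

(** * The learning rate: quadratic bounds on alpha(p) p^2 *)

Section RateFunction.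
Variable R : realType.
Implicit Types f l : R -> R.

(** The class is closed under [primitive0], so the same estimates serve both integrations inside
    [alpha]. *)
Definition unit_rate f : Prop :=
  (forall x : R, 0 <= x <= 1 -> 0 <= f x <= 1) /\
  (forall x y : R, 0 <= x -> x <= y -> y <= 1 -> f x <= f y).

Definition primitive0 f (x : R) : R :=
  \int[lebesgue_measure]_(u in [set u : R | 0 <= u <= x]) f u.

Lemma set_itv0E (x : R) : [set u : R | 0 <= u <= x] = `[0, x]%classic.
Proof. by apply/seteqP; split=> u /=; rewrite in_itv. Qed.

Lemma unit_rate_integrable f (i : interval R) : unit_rate f ->
  [set` i] `<=` `[0, 1]%classic ->
  (@lebesgue_measure R).-integrable [set` i] (EFin \o f).
Proof.
move=> [f01 fnd] i01.
suff : (@lebesgue_measure R).-integrable `[0, 1]%classic (EFin \o f).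
  by apply: integrableS.
apply: measurable_bounded_integrable => //.
- by rewrite /= lebesgue_measure_itv/= lte01 sube0 ltry.
(* [f] is controlled only on [0, 1]; precomposing with the clamp to [0, 1] gives a function monotone
   on the whole line, hence measurable, that agrees with [f] there. *)
- apply: (@eq_measurable_fun _ _ _ _ _ (fun x : R => f (Num.max 0 (Num.min x 1)))).
    move=> x; rewrite inE/= in_itv/= => /andP[x0 x1].
    by rewrite min_l// max_r.
  apply: nondecreasing_measurable => // x y xy.
  apply: fnd.
  + by rewrite le_max lexx.
  + rewrite ge_max !le_max lexx/=; apply/orP; right.
    by rewrite le_min !ge_min xy lexx orbT.
  + by rewrite ge_max ler01 ge_min lexx orbT.
- exists 1; split => // M M1 x /=; rewrite in_itv/= => /f01 /andP[f0 f1].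
  by rewrite ger0_norm// (le_trans f1)// ltW.
Qed.

(** Monotonicity traps the integral over ]s, x] between the endpoint values times the length.
    Together with [primitive00], this is all that the estimates of [gain] use about integration. *)
Lemma primitive0_bounds f s x : unit_rate f -> 0 <= s -> s <= x -> x <= 1 ->
  primitive0 f s + f s * (x - s) <= primitive0 f x <=
  primitive0 f s + f x * (x - s).
Proof.
move=> fr s0 sx x1; have [f01 fnd] := fr.
have sub1 : `]s, x]%classic `<=` `[0, 1]%classic.
  move=> u /=; rewrite !in_itv/= => /andP[su ux].
  by rewrite (le_trans s0 (ltW su)) (le_trans ux x1).
have sub2 : `[0, x]%classic `<=` `[0, 1]%classic.
  by move=> u /=; rewrite !in_itv/= => /andP[-> ux]; rewrite (le_trans ux x1).
have ifx := unit_rate_integrable fr sub2.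
have ifs := unit_rate_integrable fr sub1.
have E : primitive0 f x = primitive0 f s +
    \int[lebesgue_measure]_(u in `]s, x]) f u.
  rewrite /primitive0 !set_itv0E.
  rewrite -(@Rintegral_itvB _ f (BLeft 0) (BRight x) s)//; first by rewrite addrC subrK.
have icst c : \int[lebesgue_measure]_(u in `]s, x]) c = c * (x - s).
  rewrite Rintegral_cst//= lebesgue_measure_itv/= lte_fin.
  case: ltrP => [_|xs]; first by rewrite -EFinB.
  by rewrite (@le_anti _ _ x s) ?subrr// sx xs.
have ics (c : R) : (@lebesgue_measure R).-integrable `]s, x]%classic (EFin \o cst c).
  apply: measurable_bounded_integrable => //; last exact: bounded_cst.
  by rewrite /= lebesgue_measure_itv/=; case: ifPn => // _; rewrite -EFinB ltry.
rewrite E !lerD2l -!icst; apply/andP; split.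
  apply: le_Rintegral => //; first exact: (ics (f s)).
  move=> u /=; rewrite in_itv/= => /andP[su ux].
  by apply: fnd => //; [exact: ltW|exact: le_trans x1].
apply: le_Rintegral => //; first exact: (ics (f x)).
move=> u /=; rewrite in_itv/= => /andP[su ux].
by apply: fnd => //; exact: le_trans (ltW su).
Qed.

Lemma primitive00 f : primitive0 f 0 = 0.
Proof. by rewrite /primitive0 set_itv0E set_itv1 Rintegral_set1. Qed.

Lemma unit_rate_primitive0 f : unit_rate f -> unit_rate (primitive0 f).
Proof.
move=> fr; have [f01 fnd] := fr; split=> [x /andP[x0 x1]|x y x0 xy y1].
  have /andP[] := primitive0_bounds fr (lexx 0) x0 x1.
  have /andP[a b] : 0 <= f x <= 1 by apply: f01; rewrite x0.
  have /andP[a' b'] : 0 <= f 0 <= 1 by apply: f01; rewrite lexx ler01.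
  rewrite primitive00; nra.
have /andP[+ _] := primitive0_bounds fr x0 xy y1.
have /andP[a' b'] : 0 <= f x <= 1 by apply: f01; rewrite x0 (le_trans xy).
nra.
Qed.

(** The factor in front of the bracket of the SAMBA update; the powers of [p] cancel and leave the
    double primitive of [l] ([gainE]). *)
Definition gain l (p : R) : R := alpha l p * p ^+ 2.

Lemma gainE l p : gain l p = primitive0 (primitive0 l) p.
Proof.
rewrite /gain /alpha -/(primitive0 (primitive0 l) p).
have [->|p0] := eqVneq p 0; first by rewrite primitive00 mulr0 mul0r.
by rewrite mulrAC mulVf ?mul1r// expf_neq0.
Qed.

(** Each integration is bounded below over one half of [s, x] only: the primitive of [l] is at least
    [l s * (m - s)] at the midpoint [m] and stays so up to [x]. Hence 1/4 in place of 1/2. *)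
Lemma gain_ge l s x : unit_rate l -> 0 <= s -> s <= x -> x <= 1 ->
  l s * (x - s) ^+ 2 / 4 <= gain l x.
Proof.
move=> lr s0 sx x1; rewrite gainE.
have Lr := unit_rate_primitive0 lr.
pose m := (s + x) / 2.
have sm : s <= m by rewrite /m; lra.
have mx : m <= x by rewrite /m; lra.
have m0 : 0 <= m by lra.
have m1 : m <= 1 by lra.
have /andP[h1 _] := primitive0_bounds lr s0 sm m1.
have /andP[h2 _] := primitive0_bounds Lr m0 mx x1.
have /andP[h3 _] : 0 <= primitive0 l s <= 1 by apply: Lr.1; rewrite s0 (le_trans sx).
have /andP[h4 _] : 0 <= primitive0 (primitive0 l) m <= 1.
  by apply: (unit_rate_primitive0 Lr).1; rewrite m0.
have h5 : l s * (m - s) * (x - m) <= primitive0 l m * (x - m).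
  by apply: ler_wpM2r; lra.
have -> : l s * (x - s) ^+ 2 / 4 = l s * (m - s) * (x - m) by rewrite /m; field.
lra.
Qed.

(** Splitting the outer integral at x/2 gives 1/2 + 1/4. A constant below 1 matters: it leaves every
    coordinate a fixed fraction of its value after one step ([rewarded_ge]). *)
Lemma gain_le l x : unit_rate l -> 0 <= x <= 1 ->
  gain l x <= 3 / 4 * l x * x ^+ 2.
Proof.
move=> lr /andP[x0 x1]; rewrite gainE.
have Lr := unit_rate_primitive0 lr.
have hx0 : 0 <= x / 2 by lra.
have hxx : x / 2 <= x by lra.
have hx1 : x / 2 <= 1 by lra.
have /andP[_ h1] := primitive0_bounds lr (lexx 0) x0 x1.
have /andP[_ h2] := primitive0_bounds lr (lexx 0) hx0 hx1.
have /andP[_ h3] := primitive0_bounds Lr (lexx 0) hx0 hx1.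
have /andP[_ h4] := primitive0_bounds Lr hx0 hxx x1.
have h5 := lr.2 _ _ hx0 hxx x1.
rewrite !primitive00 in h1 h2 h3 h4.
have h6 : primitive0 l x * (x - x / 2) <= l x * x * (x / 2).
  have -> : x - x / 2 = x / 2 by field.
  by apply: ler_wpM2r => //; lra.
have h7 : primitive0 l (x / 2) * (x / 2) <= l x * (x / 2) * (x / 2).
  apply: ler_wpM2r => //.
  have : l (x / 2) * (x / 2) <= l x * (x / 2) by apply: ler_wpM2r.
  lra.
have -> : 3 / 4 * l x * x ^+ 2 = l x * x * (x / 2) + l x * (x / 2) * (x / 2).
  by field.
lra.
Qed.

Lemma gain_ge0 l x : unit_rate l -> 0 <= x <= 1 -> 0 <= gain l x.
Proof.
move=> lr /andP[x0 x1]; have := gain_ge lr x0 (lexx x) x1.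
by rewrite subrr expr0n/= mulr0 mul0r.
Qed.

(* Linear minorant of the convex bound [gain_ge]; being linear it survives
   taking expectations. *)
Lemma gain_ge_linear l s c y x : unit_rate l -> 0 <= s <= 1 -> 0 <= c ->
  0 <= y -> y <= x -> x <= 1 ->
  l s / 4 * (2 * (y - s) * c - c ^+ 2) <= gain l x.
Proof.
move=> lr /andP[s0 s1] c0 y0 yx x1.
have /andP[ls0 _] : 0 <= l s <= 1 by apply: lr.1; rewrite s0.
have x0 := le_trans y0 yx.
have k : (y - s) * c <= (x - s) * c by apply: ler_wpM2r => //; lra.
have [sx|xs] := leP s x.
  apply: (le_trans _ (gain_ge lr s0 sx x1)).
  have -> : l s * (x - s) ^+ 2 / 4 = l s / 4 * (x - s) ^+ 2 by ring.
  apply: ler_wpM2l; first lra.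
  have := sqr_ge0 (x - s - c); lra.
apply: (le_trans _ (gain_ge0 lr _)); last by rewrite x0.
apply: mulr_ge0_le0; first lra.
have : (x - s) * c <= 0 by apply: mulr_le0_ge0 => //; lra.
have := sqr_ge0 c; lra.
Qed.

End RateFunction.

(** * Deterministic sequences: slow variation, decay rate, convergence to 1 *)

Section DeterministicRate.
Variable R : realType.
Implicit Types (l : R -> R) (x : R).

(* A monotone Potter bound: slow variation forces [l] to lose at most a factor
   3/2 per halving of its argument near 0. *)
Lemma slowly_varying_dyadic l : unit_rate l -> slowly_varying_at0 l ->
  exists M : R, 0 < M /\ forall k x, 0 < x -> 2 ^+ k * x <= 1 ->
    l (2 ^+ k * x) <= M * (3 / 2) ^+ k * l x.
Proof.
move=> lr [lpos lsv].
have [x0 [x00 x01 hx0]] : exists x0 : R, [/\ 0 < x0, x0 <= 1 &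
    forall x, 0 < x -> x < x0 -> l (2 * x) <= 3 / 2 * l x].
  have /cvgrPdist_lt /(_ (1 / 2)) := lsv 2 (ltr0Sn _ _).
  move=> /(_ ltac:(lra)) [/= e e0 he].
  exists (Num.min e 1); split; [by rewrite lt_min e0 ltr01|by rewrite ge_min lexx orbT|].
  move=> x x0; rewrite lt_min => /andP[xe x1].
  have lx : 0 < l x by apply: lpos; rewrite x0 ltW.
  have := he x; rewrite /= sub0r normrN gtr0_norm// => /(_ xe x0).
  rewrite ltr_norml => /andP[+ _].
  rewrite -ler_pdivrMr// => h; lra.
have lx0 : 0 < l x0 by apply: lpos; rewrite x00.
(* Beyond the threshold [x0], monotonicity gives [l x0 <= l x], so [M * l x >= 1] and the bound is
   trivial there. *)
exists (l x0)^-1; split; first by rewrite invr_gt0.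
elim=> [|k ih] x xp.
  rewrite expr0 !mul1r mulr1 => x1.
  have : 0 < l x by apply: lpos; rewrite xp.
  have : 1 <= (l x0)^-1.
    rewrite invf_ge1//; by have /andP[] : 0 <= l x0 <= 1 by apply: lr.1; rewrite ltW.
  by move=> ? ?; rewrite ler_peMl// ltW.
have k0 : 0 < (2 : R) ^+ k by rewrite exprn_gt0.
have k1 : 1 <= (2 : R) ^+ k by rewrite exprn_ege1// ler1n.
rewrite exprS => kx.
have x1 : x <= 1 by nra.
have lx : 0 < l x by apply: lpos; rewrite xp.
have [xx0|xx0] := ltP x x0.
  have -> : 2 * 2 ^+ k * x = 2 ^+ k * (2 * x) by ring.
  have := ih (2 * x) ltac:(lra) ltac:(lra).
  move=> /le_trans; apply.
  rewrite exprS; have -> : (l x0)^-1 * (3 / 2 * (3 / 2) ^+ k) * l x =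
    (l x0)^-1 * (3 / 2) ^+ k * (3 / 2 * l x) by ring.
  apply: ler_wpM2l; last exact: hx0.
  by rewrite mulr_ge0// ?invr_ge0 ?exprn_ge0// ltW.
have /andP[_ h1] : 0 <= l (2 * 2 ^+ k * x) <= 1.
  by apply: lr.1; rewrite kx mulr_ge0// ltW// mulr_gt0.
apply: (le_trans h1).
have e1 : 1 <= (3 / 2 : R) ^+ k.+1 by rewrite exprn_ege1//; lra.
have e2 : 1 <= (l x0)^-1 * l x.
  rewrite mulrC ler_pdivlMr// mul1r; apply: lr.2 => //; exact: ltW.
have -> : (l x0)^-1 * (3 / 2) ^+ k.+1 * l x = (l x0)^-1 * l x * (3 / 2) ^+ k.+1.
  by ring.
by rewrite -[leLHS]mulr1 ler_pM.
Qed.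

Section Recursion.
Variables (l : R -> R) (y e : nat -> R) (D N Q : R).
Hypotheses (lr : unit_rate l) (lpos : forall x, 0 < x <= 1 -> 0 < l x).
Hypotheses (D0 : 0 < D) (N1 : 1 <= N).
Hypotheses (y01 : forall t, 0 <= y t <= 1) (yS : forall t, y t.+1 <= y t).
Hypotheses (e0 : forall t, 0 <= e t) (eQ : forall n, \sum_(t < n) e t <= Q).
(** For z >= 0, z^2 is the maximum over c >= 0 of 2 z c - c^2; keeping [c] free expresses a
    quadratic drift by bounds affine in [y t - e t]. *)
Hypothesis drift : forall t s c, 0 <= s <= 1 -> 0 <= c ->
  D * (l s / 4 * (2 * ((y t - e t) / N - s) * c - c ^+ 2)) <= y t - y t.+1.

Let y_le m n : (m <= n)%N -> y n <= y m.
Proof.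
move=> /subnK <-; elim: (n - m)%N => // k ih.
by rewrite addSn (le_trans _ ih).
Qed.

(** With s = c = u and y t >= 4 N u, one step loses at least D l(u) / 4 times 6 u^2 - u^2 = 5 u^2,
    up to the correction 2 u e(t) / N. The threshold is imposed at the right end only, as [y] is
    nonincreasing. *)
Let block n m u : 0 <= u <= 1 -> 4 * N * u <= y (n + m)%N ->
  D * l u / 4 * (m%:R * (5 * u ^+ 2) - 2 * u / N * \sum_(n <= t < n + m) e t)
  <= y n - y (n + m)%N.
Proof.
have hN := N1; have hD := D0.
move=> /andP[u0 u1]; elim: m => [|m ih] hu.
  by rewrite addn0 big_geq// !(mulr0, mul0r, subrr).
have hu' : 4 * N * u <= y (n + m)%N.
  by apply: (le_trans hu); rewrite addnS.
have {}ih := ih hu'.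
rewrite addnS big_nat_recr ?leq_addr//= -[m.+1]addn1 natrD.
have := @drift (n + m)%N u u; rewrite u0 u1 => /(_ isT isT).
have Np : 0 < N by lra.
have /andP[lu _] : 0 <= l u <= 1 by apply: lr.1; rewrite u0.
set S := \sum_(_ <= t < _) _ in ih *.
have : 4 * u <= y (n + m)%N / N by rewrite ler_pdivlMr//; lra.
set a := y (n + m)%N / N; rewrite mulrBl -/a.
set b := e (n + m)%N / N => h1 h2.
have h3 : D * l u / 4 * (5 * u ^+ 2 - 2 * u * b) <=
  D * (l u / 4 * (2 * (a - b - u) * u - u ^+ 2)).
  have -> : D * (l u / 4 * (2 * (a - b - u) * u - u ^+ 2)) =
    D * l u / 4 * (2 * (a - b - u) * u - u ^+ 2) by ring.
  apply: ler_wpM2l; first by rewrite mulr_ge0// mulr_ge0// ltW.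
  nra.
have -> : D * l u / 4 * ((m%:R + 1%:R) * (5 * u ^+ 2) - 2 * u / N * (S + e (n + m)%N))
  = D * l u / 4 * (m%:R * (5 * u ^+ 2) - 2 * u / N * S)
   + D * l u / 4 * (5 * u ^+ 2 - 2 * u * b) by rewrite /b; ring.
lra.
Qed.

Let Q0 : 0 <= Q. Proof. by have := eQ 0; rewrite big_ord0. Qed.

(** Here [u] is the largest value that [block] accepts. The condition on [Q] lets the sum of [e]
    consume at most 4 n u^2 of the 5 n u^2, and the total decrease is at most [y n]. *)
Let double n : 4 * Q <= n%:R * y (n + n)%N ->
  D * l (y (n + n)%N / (4 * N)) * (n%:R * (y (n + n)%N / (4 * N)) ^+ 2) <= 4 * y n.
Proof.
have hN := N1; have hD := D0.
set u := y (n + n)%N / (4 * N) => hQ.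
have Np : 0 < N by lra.
have /andP[Y0 Y1] := y01 (n + n).
have u0 : 0 <= u by rewrite divr_ge0//; lra.
have uY : y (n + n)%N = 4 * N * u by rewrite /u; field; lra.
have u1 : u <= 1 by rewrite ler_pdivrMr; lra.
have := @block n n u; rewrite u0 u1 uY lexx => /(_ isT isT).
have Se : \sum_(n <= t < n + n) e t <= Q.
  apply: (le_trans _ (eQ (n + n))); rewrite -(big_mkord xpredT e).
  rewrite (@big_cat_nat _ _ _ n 0 (n + n))//= ?leq_addl// lerDr.
  exact: sumr_ge0.
have S0 : 0 <= \sum_(n <= t < n + n) e t by exact: sumr_ge0.
set S := \sum_(_ <= t < _) _ in Se S0 *.
have /andP[lu _] : 0 <= l u <= 1 by apply: lr.1; rewrite u0.
have hS : 2 * u / N * S <= n%:R * (4 * u ^+ 2).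
  have : S / N <= n%:R * u.
    rewrite ler_pdivrMr//; rewrite uY in hQ.
    by apply: (le_trans Se); have := hQ; set z := n%:R; nra.
  move=> h; have -> : 2 * u / N * S = 2 * u * (S / N) by ring.
  have h0 : 0 <= n%:R * u * u by rewrite mulr_ge0// mulr_ge0.
  have : 2 * u * (S / N) <= 2 * u * (n%:R * u) by apply: ler_wpM2l => //; lra.
  have : 2 * u * (n%:R * u) = 2 * (n%:R * u * u) by ring.
  have : n%:R * (4 * u ^+ 2) = 4 * (n%:R * u * u) by ring.
  lra.
have hD4 : 0 <= D * l u / 4 by rewrite mulr_ge0// mulr_ge0// ltW.
have : D * l u / 4 * (n%:R * u ^+ 2) <=
    D * l u / 4 * (n%:R * (5 * u ^+ 2) - 2 * u / N * S).
  apply: ler_wpM2l; first by rewrite mulr_ge0// mulr_ge0// ltW.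
  have : n%:R * (5 * u ^+ 2) = n%:R * (4 * u ^+ 2) + n%:R * u ^+ 2 by ring.
  lra.
have /andP[+ _] := y01 (n + n); rewrite uY.
lra.
Qed.

(** The summands serve [decay] in turn: 1 for its base case, 8 Q for the condition of [double], 8 N
    for 1/n <= u, and 256 N^2 / D for the final contradiction. *)
Let B : R := 1 + 8 * Q + 8 * N + 256 * N ^+ 2 / D.

Let ND0 : 0 <= 256 * N ^+ 2 / D.
Proof. by apply: divr_ge0 (ltW D0); apply: mulr_ge0 => //; exact: sqr_ge0. Qed.

(** Induction by contradiction. With n = 2^k and w = l(1/n), [double] multiplied by n w and the
    bound at 2^k give D (n u w)^2 <= 4 B, whereas failure at 2^(k+1) means n u w > B / (8 N);
    together D B < 256 N^2. *)
Let decay k : y (2 ^ k)%N * (2 ^+ k * l (2 ^- k)) <= B.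
Proof.
have hN := N1; have hD := D0; have hQ0 := Q0; have hND := ND0.
have B1 : 1 <= B by rewrite /B; lra.
elim: k => [|k ih].
  rewrite expr0 invr1 mul1r.
  have /andP[a b] := y01 (2 ^ 0).
  have /andP[c d] : 0 <= l 1 <= 1 by apply: lr.1; rewrite ler01 lexx.
  by apply: le_trans B1; rewrite mulr_ile1.
rewrite leNgt; apply/negP => hB.
have e2 : (2 ^ k.+1 = 2 ^ k + 2 ^ k)%N by rewrite expnS mul2n addnn.
have Np : 0 < N by lra.
have n1 : 1 <= (2 : R) ^+ k by rewrite exprn_ege1// ler1n.
have w'0 : 0 < l (2 ^- k.+1).
  apply: lpos; rewrite invr_gt0 exprn_gt0//= invf_le1 ?exprn_gt0//.
  by rewrite exprn_ege1// ler1n.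
have w0 : 0 < l (2 ^- k).
  by apply: lpos; rewrite invr_gt0 exprn_gt0//= invf_le1 ?exprn_gt0.
have ww : l (2 ^- k.+1) <= l (2 ^- k).
  apply: lr.2; rewrite ?invr_ge0 ?exprn_ge0//.
    by rewrite lef_pV2 ?posrE ?exprn_gt0// exprS ler_peMl ?ler1n// exprn_ge0.
  by rewrite invf_le1 ?exprn_gt0.
have /andP[_ w1] : 0 <= l (2 ^- k) <= 1.
  by apply: lr.1; rewrite invr_ge0 exprn_ge0//= invf_le1 ?exprn_gt0.
have := @double (2 ^ k)%N; rewrite -e2 natrX.
have /andP[Y0 Y1] := y01 (2 ^ k.+1); move: Y0 Y1 hB.
set Y := y (2 ^ k.+1)%N; set Yn := y (2 ^ k)%N in ih *.
rewrite exprS in w'0 ww *; set n := (2 : R) ^+ k in ih n1 w0 w1 w'0 ww *.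
set w := l (n^-1) in ih w0 w1 ww *.
set w' := l (2 * n)^-1 in w'0 ww *.
move=> Y0 Y1 hB.
have hB2 : B < Y * (2 * n).
  apply: (lt_le_trans hB); apply: ler_wpM2l => //.
  by rewrite ler_piMr//; lra.
have hQ : 4 * Q <= n * Y by rewrite /B in hB2; lra.
move=> /(_ hQ).
set u := Y / (4 * N).
have uY : Y = 4 * N * u by rewrite /u; field; lra.
have u0 : 0 <= u by rewrite divr_ge0//; lra.
have u1 : u <= 1 by rewrite ler_pdivrMr; lra.
have nu : n^-1 <= u.
  rewrite -[n^-1]mul1r ler_pdivrMr; last lra.
  have : 8 * N < 4 * N * u * (2 * n) by rewrite -uY; move: hB2; rewrite /B; lra.
  rewrite leNgt; move=> h; apply/negP => h'.
  have : 8 * N * (u * n) <= 8 * N * 1 by apply: ler_wpM2l; lra.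
  lra.
have wu : w <= l u.
  by apply: lr.2 => //; rewrite invr_ge0; lra.
move=> h1.
have h2 : D * (n * u * w) ^+ 2 <= 4 * B.
  apply: (le_trans (y := D * l u * (n * u ^+ 2) * (n * w))).
    have -> : D * (n * u * w) ^+ 2 = D * w * (n * u ^+ 2) * (n * w) by ring.
    apply: ler_wpM2r; first by rewrite mulr_ge0//; lra.
    apply: ler_wpM2r; first by rewrite mulr_ge0// ?sqr_ge0//; lra.
    by apply: ler_wpM2l => //; exact: ltW.
  apply: (le_trans (y := 4 * Yn * (n * w))).
    by apply: ler_wpM2r => //; rewrite mulr_ge0//; lra.
  lra.
have h3 : B < 8 * N * (n * u * w).
  apply: (lt_le_trans hB); rewrite uY.
  have -> : 4 * N * u * (2 * n * w') = 8 * N * (n * u) * w' by ring.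
  have -> : 8 * N * (n * u * w) = 8 * N * (n * u) * w by ring.
  apply: ler_wpM2l => //; apply: mulr_ge0; first lra.
  by apply: mulr_ge0 => //; lra.
have h4 : B ^+ 2 < (8 * N * (n * u * w)) ^+ 2.
  by rewrite ltr_pXn2r// nnegrE; lra.
have h5 : D * B ^+ 2 < 256 * N ^+ 2 * B.
  apply: (lt_le_trans (y := D * (8 * N * (n * u * w)) ^+ 2)).
    by rewrite ltr_pM2l.
  have -> : D * (8 * N * (n * u * w)) ^+ 2 =
     64 * N ^+ 2 * (D * (n * u * w) ^+ 2) by ring.
  have -> : 256 * N ^+ 2 * B = 64 * N ^+ 2 * (4 * B) by ring.
  by apply: ler_wpM2l => //; rewrite mulr_ge0// sqr_ge0.
have h6 : D * B < 256 * N ^+ 2.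
  rewrite -(@ltr_pM2r _ B); last lra.
  by rewrite -mulrA -expr2.
have : 256 * N ^+ 2 <= D * B.
  rewrite [leRHS]mulrC -ler_pdivrMr// /B; lra.
lra.
Qed.

Let sum_dyadic k : \sum_(t < (2 ^ k)%N) y t <= 1 + \sum_(j < k) 2 ^+ j * y (2 ^ j)%N.
Proof.
have hN := N1; have hD := D0; have hQ0 := Q0; have hND := ND0.
elim: k => [|k ih].
  by rewrite big_ord_recr !big_ord0/= add0r addr0; case/andP: (y01 0).
rewrite big_ord_recr/= addrA; apply: le_trans (lerD ih (lexx _)).
rewrite -!(big_mkord xpredT).
have e2 : (2 ^ k.+1 = 2 ^ k + 2 ^ k)%N by rewrite expnS mul2n addnn.
rewrite (@big_cat_nat _ _ _ (2 ^ k)%N)//= ?e2 ?leq_addl// lerD2l.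
apply: (le_trans (y := \sum_(2 ^ k <= i < 2 ^ k + 2 ^ k) y (2 ^ k)%N)).
  by apply: ler_sum_nat => i /andP[h _]; exact: y_le.
by rewrite sumr_const_nat addnK -[leLHS]mulr_natl natrX.
Qed.

Lemma sum_rate : exists2 K, 0 <= K & forall T, (2 <= T)%N ->
  \sum_(t < T) y t <= 1 + K * ln T%:R / l T%:R^-1.
Proof.
have hN := N1; have hD := D0; have hQ0 := Q0; have hND := ND0.
exists (2 * B / ln 2).
  by rewrite divr_ge0 ?ln_ge0 ?ler1n// /B; lra.
move=> T T2; pose k := trunc_log 2 T.
have T0 : (0 < T)%N by apply: leq_trans T2.
have Tp : 0 < T%:R :> R by rewrite ltr0n.
have kT : (2 ^ k <= T)%N by apply: trunc_logP.
have Tk : (T < 2 ^ k.+1)%N by apply: trunc_log_ltn.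
have k1 : (1 <= k)%N by rewrite trunc_log_gt0//.
have B1 : 1 <= B by rewrite /B; lra.
have lT : 0 < l T%:R^-1.
  by apply: lpos; rewrite invr_gt0 Tp invf_le1// ler1n.
apply: (le_trans (y := \sum_(t < (2 ^ k.+1)%N) y t)).
  rewrite -!(big_mkord xpredT y) (@big_cat_nat _ _ _ T 0 (2 ^ k.+1))//=; last exact: ltnW.
  by rewrite lerDl sumr_ge0// => i _; case/andP: (y01 i).
apply: (le_trans (sum_dyadic _)); rewrite lerD2l.
(* Every dyadic block starts at 2^j <= T, so [decay] and the monotonicity of [l] bound its
   contribution by B / l(1/T). *)
apply: (le_trans (y := \sum_(j < k.+1) B / l T%:R^-1)).
  apply: ler_sum => -[j jk] _ /=.
  have jT : (2 ^ j <= T)%N by apply: leq_trans kT; rewrite leq_exp2l.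
  have jT' : (2 : R) ^+ j <= T%:R by rewrite -natrX ler_nat.
  have j0 : 0 < (2 : R) ^+ j by rewrite exprn_gt0.
  have j1 : 1 <= (2 : R) ^+ j by rewrite exprn_ege1// ler1n.
  rewrite ler_pdivlMr//; apply: le_trans (decay j).
  rewrite [2 ^+ j * _]mulrC -mulrA; apply: ler_wpM2l; first by case/andP: (y01 (2 ^ j)).
  rewrite ler_pM2l//; apply: lr.2.
  - by rewrite invr_ge0 ltW.
  - by rewrite lef_pV2 ?posrE.
  - by rewrite invf_le1.
rewrite sumr_const card_ord -[leLHS]mulr_natl.
(* T >= 2 gives k >= 1, so the k + 1 blocks number at most 2 k <= 2 ln T / ln 2. *)
have -> : 2 * B / ln 2 * ln T%:R / l T%:R^-1 = 2 * (ln T%:R / ln 2) * (B / l T%:R^-1).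
  by field; rewrite !gt_eqF// ln_gt0// ltr1n.
apply: ler_wpM2r; first by rewrite divr_ge0//; lra.
have ln2 : 0 < ln (2 : R) by rewrite ln_gt0// ltr1n.
have : k%:R <= ln T%:R / ln 2 :> R.
  rewrite ler_pdivlMr// mulr_natl -lnXn// ler_ln ?posrE ?exprn_gt0//.
  by rewrite -natrX ler_nat.
have : 1 <= k%:R :> R by rewrite ler1n.
rewrite -natr1; lra.
Qed.

End Recursion.

(** Moving the argument from 1/T to 2^m / T costs a factor M (3/2)^m by the dyadic bound, while the
    constant gains 2^m; for large m the gain also absorbs [K]. *)
Lemma rate_constant l (D N K : R) : unit_rate l -> slowly_varying_at0 l ->
  0 < D -> 1 <= N -> 0 <= K ->
  exists C : R, 0 < C /\ forall T : nat, (0 < T)%N -> C / (D * T%:R) <= 1 ->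
    (2 <= T)%N /\
    K * ln T%:R / l T%:R^-1 <= C * N / (D * l (C / (D * T%:R))) * ln T%:R.
Proof.
move=> lr lsv D0 N1 K0; have [M [M0 hM]] := slowly_varying_dyadic lr lsv.
have [m [m1 hm]] : exists m, (0 < m)%N /\ K * M * (3 / 2) ^+ m <= 2 ^+ m.
  have /cvgrPdist_lt /(_ ((K * M + 1)^-1)) : (3 / 4 : R) ^+ n @[n --> \oo] --> 0.
    by apply: cvg_expr; rewrite ger0_norm; lra.
  have KM : 0 <= K * M by rewrite mulr_ge0// ltW.
  move=> /(_ ltac:(by rewrite invr_gt0; lra)) [n _ hn].
  exists n.+1; split => //.
  have := hn n.+1 (leqnSn n); rewrite sub0r normrN ger0_norm; last first.
    by rewrite exprn_ge0//; lra.
  rewrite -[X in _ < X]mul1r ltr_pdivlMr; last lra.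
  move=> h.
  have -> : (3 / 2 : R) = 2 * (3 / 4) by field.
  have p0 : 0 < (2 : R) ^+ n.+1 by rewrite exprn_gt0.
  have q0 : 0 <= (3 / 4 : R) ^+ n.+1 by rewrite exprn_ge0//; lra.
  rewrite exprMn mulrCA -[leRHS]mulr1 ler_pM2l//.
  lra.
have p2 : 2 <= (2 : R) ^+ m.
  by case: m m1 {hm} => // m _; rewrite exprS ler_peMr// exprn_ege1// ler1n.
(* The factor [D] cancels, so [l] is evaluated at 2^m / T. Since m >= 1, this argument can be at
   most 1 only if T >= 2. *)
exists (D * 2 ^+ m); split; first by rewrite mulr_gt0//; lra.
move=> T T0.
have Tp : 0 < T%:R :> R by rewrite ltr0n.
have -> : D * 2 ^+ m / (D * T%:R) = 2 ^+ m * T%:R^-1 by field; rewrite ?gt_eqF.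
move=> hT.
have T2 : (2 <= T)%N.
  rewrite -(ler_nat R); apply: (le_trans p2).
  by move: hT; rewrite ler_pdivrMr// mul1r.
split => //.
have l1 : 0 < l T%:R^-1.
  by apply: lsv.1; rewrite invr_gt0 Tp invf_le1// ler1n.
have l2 : 0 < l (2 ^+ m * T%:R^-1).
  by apply: lsv.1; rewrite hT andbT mulr_gt0 ?invr_gt0//; lra.
have Tv : 0 < T%:R^-1 :> R by rewrite invr_gt0.
have := hM m _ Tv hT.
set l2' := l (_ * _) in l2 *; set l1' := l _ in l1 * => h.
have -> : D * 2 ^+ m * N / (D * l2') * ln T%:R = 2 ^+ m * N / l2' * ln T%:R.
  by field; rewrite ?gt_eqF.
have -> : K * ln T%:R / l1' = K / l1' * ln T%:R by ring.
apply: ler_wpM2r; first by rewrite ln_ge0// ler1n.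
rewrite ler_pdivrMr// mulrAC ler_pdivlMr//.
apply: (le_trans (y := K * (M * (3 / 2) ^+ m * l1'))).
  by apply: ler_wpM2l.
have -> : K * (M * (3 / 2) ^+ m * l1') = K * M * (3 / 2) ^+ m * l1' by ring.
apply: ler_wpM2r; first exact: ltW.
by apply: (le_trans hm); rewrite ler_peMr//; lra.
Qed.

End DeterministicRate.

(* Once close to 1 the sequence cannot jump close to 0, so a sequence that is
   eventually close to {0, 1} and does not vanish tends to 1. *)
Lemma cvg1_of_dichotomy (R : realType) (N : R) (x : nat -> R) : 1 <= N ->
  (forall t, 0 <= x t <= 1) -> (forall t, x t / 4 <= x t.+1) ->
  (forall j : nat, exists n : nat, forall t, (n <= t)%N ->
     ~ (j.+1%:R^-1 <= x t /\ j.+1%:R^-1 <= (1 - x t) / N)) ->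
  ~ (forall j : nat, exists n : nat, forall t, (n <= t)%N -> x t <= j.+1%:R^-1) ->
  x t @[t --> \oo] --> (1 : R).
Proof.
move=> N1 x01 xS dich nvan.
have Np : 0 < N by lra.
have hi j t : ~ (j.+1%:R^-1 <= x t /\ j.+1%:R^-1 <= (1 - x t) / N) ->
    j.+1%:R^-1 <= x t -> 1 - x t < N / j.+1%:R.
  move=> nh h; rewrite ltNge; apply/negP => h'; apply: nh; split => //.
  by rewrite ler_pdivlMr// mulrC.
have [j1 hj1] : exists j : nat, forall n, exists2 t, (n <= t)%N & j.+1%:R^-1 < x t.
  apply: contrapT => nj; apply: nvan => j; apply: contrapT => nn.
  apply: nj; exists j => n; apply: contrapT => nt; apply: nn; exists n => t nt'.
  by rewrite leNgt; apply/negP => h; apply: nt; exists t.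
(* The term 2 N puts every value on the high side above 1/2; the term 8 keeps 1/8, a lower bound one
   step after a value above 1/2, over the low threshold. The second condition puts the recurrent
   visits on the high side. *)
have [j [jN jj]] : exists j : nat, 2 * N + 8 < j.+1%:R /\ j.+1%:R^-1 <= j1.+1%:R^-1 :> R.
  exists (maxn j1 (truncn (2 * N + 8))); split.
    by apply: (lt_le_trans (truncnS_gt _)); rewrite ler_nat ltnS leq_maxr.
  by rewrite lef_pV2 ?posrE// ler_nat ltnS leq_maxl.
have jp : 0 < j.+1%:R :> R by [].
have N2 : N / j.+1%:R <= 1 / 2 by rewrite ler_pdivrMr//; lra.
have j8 : j.+1%:R^-1 <= 1 / 8 :> R by rewrite -[leLHS]mul1r ler_pdivrMr//; lra.
have [n hn] := dich j.
have [t1 nt1 xt1] := hj1 n.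
have high t : (t1 <= t)%N -> 1 / 2 < x t.
  move=> /subnKC <-; elim: (t - t1)%N => [|k ih].
    rewrite addn0.
    have := lt_le_trans (hi j t1 (hn t1 nt1) (le_trans jj (ltW xt1))) N2; lra.
  rewrite addnS; have xk := xS (t1 + k)%N.
  have nk : (n <= (t1 + k).+1)%N by rewrite -addnS (leq_trans nt1)// leq_addr.
  have xj : j.+1%:R^-1 <= x (t1 + k).+1 by apply: (le_trans j8); lra.
  have := lt_le_trans (hi j _ (hn _ nk) xj) N2; lra.
apply/cvgrPdist_lt => e e0.
pose j' := maxn 1 (truncn (N / e)).
have [n' hn'] := dich j'.
exists (maxn t1 n') => // t /=; rewrite geq_max => /andP[tt1 tn'].
have xh := high t tt1; have /andP[_ x1] := x01 t.
have jp' : 0 < j'.+1%:R :> R by [].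
have lt1 : 1 - x t < N / j'.+1%:R.
  apply: hi; first exact: hn'.
  apply: (le_trans _ (ltW xh)); rewrite mul1r lef_pV2 ?posrE//.
  by rewrite ler_nat ltnS leq_maxl.
have lt2 : N / j'.+1%:R <= e.
  rewrite ler_pdivrMr// mulrC -ler_pdivrMr//.
  apply/ltW; apply: (lt_le_trans (truncnS_gt _)).
  by rewrite ler_nat ltnS leq_maxr.
by rewrite ger0_norm ?subr_ge0//; exact: lt_le_trans lt2.
Qed.

(** * One step of the dynamics on the simplex *)

Section OneStep.
Variables (R : realType) (A : finType) (l : R -> R).
Hypothesis lr : unit_rate l.
Implicit Types (q : A -> R) (a b c k : A).

Definition simplex q : Prop := (forall a, 0 < q a) /\ \sum_a q a = 1.

Definition is_leader q k : Prop := forall b, q b <= q k.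

(** Only the reward of the played arm affects the update, so the constant reward 1 represents every
    outcome in which that arm pays. *)
Definition rewarded q k a : A -> R := samba_step l q k a (fun=> 1).

Lemma sum_cst (x : R) : \sum_(c : A) x = #|A|%:R * x.
Proof. by rewrite (eq_bigl (mem A))// sumr_const mulr_natl. Qed.

Lemma simplex_itv q a : simplex q -> 0 <= q a <= 1.
Proof.
move=> [q0 q1]; rewrite (ltW (q0 a))/= -q1 (bigD1 a)//= lerDl.
by apply: sumr_ge0 => b _; exact: ltW.
Qed.

Lemma simplex_gain_ge0 q a : simplex q -> 0 <= gain l (q a).
Proof. by move=> sq; apply: gain_ge0 => //; exact: simplex_itv. Qed.

Lemma simplex_gain_le q a : simplex q -> gain l (q a) <= 3 / 4 * q a ^+ 2.
Proof.
move=> sq; have q01 := simplex_itv a sq.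
apply: (le_trans (gain_le lr q01)); apply: ler_wpM2r; first exact: sqr_ge0.
have /andP[] := lr.1 _ q01; lra.
Qed.

Lemma samba_newE q k a rw b : samba_new l q k a rw b =
  q b + gain l (q b) * ((a == b)%:R * rw b / q b - (a == k)%:R * rw k / q k).
Proof. by []. Qed.

Lemma simplex_compl q k : simplex q -> \sum_(c | c != k) q c = 1 - q k.
Proof. by move=> [_ <-]; rewrite [in RHS](bigD1 k)//= addrAC subrr add0r. Qed.

(** Each term of the bracket carries the indicator that its own arm is played, so the reward of [a]
    comes out as a common factor. *)
Lemma samba_stepE q k a (rho : A -> bool) : simplex q ->
  samba_step l q k a (fun b => (rho b)%:R) = if rho a then rewarded q k a else q.
Proof.
move=> sq; have newE b rw : samba_new l q k a rw b =
    q b + gain l (q b) * rw a * ((a == b)%:R / q b - (a == k)%:R / q k).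
  rewrite samba_newE; have [->|_] := eqVneq a b; have [->|_] := eqVneq _ k;
    rewrite ?eqxx /=; ring.
apply/funext => b; case: ifPn => ra; rewrite /rewarded /samba_step.
  have [_|_] := eqVneq b k; last by rewrite !newE ra.
  by congr (1 - _); apply: eq_bigr => c _; rewrite !newE ra.
have new0 c : samba_new l q k a (fun b => (rho b)%:R) c = q c.
  by rewrite newE (negbTE ra) mulr0 mul0r addr0.
rewrite new0; have [->|//] := eqVneq b k.
by rewrite (eq_bigr q)// simplex_compl// subKr.
Qed.

Lemma rewarded_leader q k b : b != k ->
  rewarded q k k b = q b - gain l (q b) / q k.
Proof.
move=> bk; rewrite /rewarded /samba_step (negbTE bk) samba_newE.
by rewrite eq_sym (negbTE bk) eqxx /=; ring.
Qed.

Lemma rewarded_self q k b : b != k ->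
  rewarded q k b b = q b + gain l (q b) / q b.
Proof.
move=> bk; rewrite /rewarded /samba_step (negbTE bk) samba_newE.
by rewrite (negbTE bk) eqxx /=; ring.
Qed.

Lemma rewarded_other q k a b : b != k -> a != b -> a != k ->
  rewarded q k a b = q b.
Proof.
move=> bk ab ak; rewrite /rewarded /samba_step (negbTE bk) samba_newE.
by rewrite (negbTE ab) (negbTE ak) /=; ring.
Qed.

Lemma rewarded_leader_leader q k : simplex q ->
  rewarded q k k k = q k + (\sum_(c | c != k) gain l (q c)) / q k.
Proof.
move=> sq; rewrite /rewarded /samba_step eqxx.
rewrite (eq_bigr (fun c => q c - gain l (q c) / q k)); last first.
  by move=> c ck; rewrite -rewarded_leader// /rewarded /samba_step (negbTE ck).
by rewrite sumrB (simplex_compl k sq) mulr_suml; ring.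
Qed.

Lemma rewarded_follower_leader q k a : simplex q -> a != k ->
  rewarded q k a k = q k - gain l (q a) / q a.
Proof.
move=> sq ak; rewrite /rewarded /samba_step eqxx.
rewrite (eq_bigr (fun c => q c + (a == c)%:R * (gain l (q c) / q c))); last first.
  by move=> c ck; rewrite samba_newE (negbTE ak) /=; ring.
rewrite big_split/= simplex_compl// (bigD1 a)//= eqxx /= big1 ?addr0; first by ring.
by move=> c /andP[_ ca]; rewrite eq_sym (negbTE ca) mul0r.
Qed.

(** A leader loses at most gain(q a) / q a <= 3/4 q a <= 3/4 q k, and a follower at most gain(q b) /
    q k <= 3/4 q b. This gives positivity of the next state and forbids a fall from near 1 to near
    0. *)
Lemma rewarded_ge q k a b : simplex q -> is_leader q k ->
  q b / 4 <= rewarded q k a b.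
Proof.
move=> sq lk; have [q0 _] := sq.
have gq c : gain l (q c) / q c <= 3 / 4 * q c.
  rewrite ler_pdivrMr// (_ : 3 / 4 * q c * q c = 3 / 4 * q c ^+ 2); last by ring.
  exact: simplex_gain_le.
have gq0 c : 0 <= gain l (q c) / q c.
  by rewrite divr_ge0 ?simplex_gain_ge0// ltW.
have := q0 b; have [->|bk] := eqVneq b k.
  have [->|ak] := eqVneq a k; last first.
    rewrite rewarded_follower_leader//; have := gq a; have := lk a; lra.
  rewrite rewarded_leader_leader//.
  have : 0 <= (\sum_(c | c != k) gain l (q c)) / q k.
    apply: divr_ge0 (ltW (sq.1 k)); apply: sumr_ge0 => c _; exact: simplex_gain_ge0.
  lra.
have [->|ak] := eqVneq a k.
  rewrite rewarded_leader//.
  have : gain l (q b) / q k <= gain l (q b) / q b.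
    apply: ler_wpM2l; first exact: simplex_gain_ge0.
    by rewrite lef_pV2 ?posrE.
  have := gq b; lra.
have [->|ab] := eqVneq a b; last by rewrite rewarded_other//; lra.
rewrite rewarded_self//; have := gq0 b; lra.
Qed.

Lemma simplex_rewarded q k a : simplex q -> is_leader q k ->
  simplex (rewarded q k a).
Proof.
move=> sq lk; split=> [b|].
  apply: lt_le_trans (rewarded_ge a b sq lk); have := sq.1 b; lra.
rewrite (bigD1 k)//= {1}/rewarded /samba_step eqxx.
rewrite [X in _ + X](eq_bigr (samba_new l q k a (fun=> 1))) ?subrK// => b bk.
by rewrite /rewarded /samba_step (negbTE bk).
Qed.

(** * Conditional drift of the optimal coordinate *)

Section Optimal.
Variables (r : A -> R) (astar : A) (D : R).
Hypotheses (r01 : forall a, 0 <= r a <= 1) (D0 : 0 < D)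
           (Dr : forall a, a != astar -> D <= r astar - r a).

(* Conditional expected increment of [h (p_astar)] when the leader is [k];
   unrewarded plays do not move the state. *)
Definition increment (h : R -> R) q k : R :=
  \sum_a q a * r a * (h (rewarded q k a astar) - h (q astar)).

Lemma increment_leader h q : simplex q -> increment h q astar =
  q astar * r astar *
    (h (q astar + (\sum_(c | c != astar) gain l (q c)) / q astar) - h (q astar)) +
  \sum_(a | a != astar) q a * r a *
    (h (q astar - gain l (q a) / q a) - h (q astar)).
Proof.
move=> sq; rewrite /increment (bigD1 astar)//= rewarded_leader_leader//.
by congr (_ + _); apply: eq_bigr => a an; rewrite rewarded_follower_leader.
Qed.

Lemma increment_follower h q k : simplex q -> k != astar ->
  increment h q k =
  q astar * r astar * (h (q astar + gain l (q astar) / q astar) - h (q astar)) +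
  q k * r k * (h (q astar - gain l (q astar) / q k) - h (q astar)).
Proof.
move=> sq kn; rewrite /increment (bigD1 astar)//= rewarded_self; last by rewrite eq_sym.
rewrite (bigD1 k)//= rewarded_leader; last by rewrite eq_sym.
rewrite big1 ?addr0// => a /andP[an ak].
by rewrite rewarded_other ?subrr ?mulr0// eq_sym.
Qed.

(** The probability of playing an arm cancels the denominator of its importance weight; only gains
    and mean rewards remain. *)
Lemma increment_id_leader q : simplex q ->
  increment id q astar = \sum_(c | c != astar) gain l (q c) * (r astar - r c).
Proof.
move=> sq; rewrite increment_leader//=.
have q0 a : q a != 0 by rewrite gt_eqF// sq.1.
under [X in _ + X]eq_bigr => a _.
  rewrite (_ : _ * _ = - (gain l (q a) * r a)); last by field.
  over.
under [in RHS]eq_bigr do rewrite mulrBr.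
rewrite sumrB sumrN -mulr_suml; congr (_ - _).
by field.
Qed.

Lemma increment_id_follower q k : simplex q -> k != astar ->
  increment id q k = gain l (q astar) * (r astar - r k).
Proof.
move=> sq kn; rewrite increment_follower//=.
have q0 a : q a != 0 by rewrite gt_eqF// sq.1.
by field; rewrite !q0.
Qed.

(** The boolean equation selects the arms whose gain drives the drift: any suboptimal arm when
    [astar] leads, [astar] itself otherwise. All terms are nonnegative, so one alone is a lower
    bound. *)
Lemma increment_id_ge_gain q k a : simplex q ->
  (k == astar) = (a != astar) -> D * gain l (q a) <= increment id q k.
Proof.
move=> sq; have [-> /esym an|kn /esym/negbFE/eqP ->] := eqVneq k astar.
  rewrite increment_id_leader// (bigD1 a)//= mulrC.
  apply: (le_trans (y := gain l (q a) * (r astar - r a))).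
    by apply: ler_wpM2l; [exact: simplex_gain_ge0|exact: Dr].
  rewrite lerDl sumr_ge0// => c /andP[cn _]; rewrite mulr_ge0 ?simplex_gain_ge0//.
  by apply: le_trans (Dr cn); exact: ltW.
rewrite increment_id_follower// mulrC.
by apply: ler_wpM2l; [exact: simplex_gain_ge0|exact: Dr].
Qed.

Lemma increment_id_ge0 q k : simplex q -> 0 <= increment id q k.
Proof.
move=> sq; have [->|kn] := eqVneq k astar.
  rewrite increment_id_leader// sumr_ge0// => c cn.
  rewrite mulr_ge0 ?simplex_gain_ge0//.
  by apply: le_trans (Dr cn); exact: ltW.
apply: (le_trans _ (increment_id_ge_gain (a := astar) sq _)).
  by rewrite mulr_ge0 ?simplex_gain_ge0// ltW.
by rewrite eqxx (negbTE kn).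
Qed.

(** If all suboptimal arms were below the threshold, their sum would fall short of [1 - q astar] by
    one positive threshold, as they number #|A| - 1. *)
Lemma exists_large_follower q : simplex q -> q astar < 1 ->
  exists2 c, c != astar & (1 - q astar) / #|A|%:R <= q c.
Proof.
move=> sq q1; apply: contrapT => nex.
have N0 : 0 < #|A|%:R :> R by rewrite ltr0n; apply/card_gt0P; exists astar.
set y := (1 - q astar) / #|A|%:R in nex.
have y0 : 0 < y by rewrite divr_gt0// subr_gt0.
have := simplex_compl astar sq.
have : \sum_(c | c != astar) q c <= \sum_(c | c != astar) y.
  apply: ler_sum => c cn; rewrite leNgt; apply/negP => yc.
  by apply: nex; exists c => //; exact: ltW.
have : \sum_(c : A) y = 1 - q astar.
  by rewrite sum_cst /y mulrC divfK ?gt_eqF.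
rewrite (bigD1 astar)//=; lra.
Qed.

(** Whichever arm leads, some arm of mass at least [eta] drives the drift; [gain_ge] with s = eta /
    2 then bounds it away from 0 while [astar] is undecided. *)
Lemma increment_id_ge q k eta : simplex q ->
  0 < eta -> eta <= q astar -> eta <= (1 - q astar) / #|A|%:R ->
  D * (l (eta / 2) * (eta / 2) ^+ 2 / 4) <= increment id q k.
Proof.
move=> sq e0 e1 e2.
have N0 : 0 < #|A|%:R :> R by rewrite ltr0n; apply/card_gt0P; exists astar.
have [a ha ea] : exists2 a, (k == astar) = (a != astar) & eta <= q a.
  have [_|_] := eqVneq k astar; last by exists astar => //; rewrite eqxx.
  have [|c cn hc] := @exists_large_follower q sq.
    rewrite -subr_gt0; have : 0 < (1 - q astar) / #|A|%:R by lra.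
    by rewrite pmulr_lgt0// invr_gt0.
  by exists c; [rewrite cn|exact: le_trans hc].
apply: le_trans (increment_id_ge_gain sq ha); rewrite ler_pM2l//.
have /andP[qa0 qa1] := simplex_itv a sq.
have e20 : 0 <= eta / 2 by lra.
apply: le_trans (gain_ge lr e20 _ qa1); last lra.
have /andP[le0 _] : 0 <= l (eta / 2) <= 1 by apply: lr.1; rewrite e20; lra.
rewrite ler_pM2r//; apply: ler_wpM2l => //.
by rewrite lerXn2r ?nnegrE//; lra.
Qed.

(** Above 1/2, [astar] is the leader and a large follower carries the bound. At most 1/2, another
    arm may lead; substituting 0 for [1 - q astar] makes the left side nonpositive. *)
Lemma increment_id_ge_linear q k (s c : R) : simplex q -> is_leader q k ->
  0 <= s <= 1 -> 0 <= c ->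
  D * (l s / 4 * (2 * ((if q astar <= 2^-1 then 0 else 1 - q astar) / #|A|%:R - s) * c
        - c ^+ 2)) <= increment id q k.
Proof.
move=> sq lk /andP[s0 s1] c0.
have N0 : 0 < #|A|%:R :> R by rewrite ltr0n; apply/card_gt0P; exists astar.
have /andP[ls0 _] : 0 <= l s <= 1 by apply: lr.1; rewrite s0.
have trivial : D * (l s / 4 * (2 * (0 / #|A|%:R - s) * c - c ^+ 2)) <= increment id q k.
  apply: le_trans (increment_id_ge0 k sq); rewrite pmulr_rle0//.
  apply: mulr_ge0_le0; first lra.
  rewrite mul0r sub0r; have : 0 <= s * c by exact: mulr_ge0.
  have := sqr_ge0 c; lra.
case: ifPn => //; rewrite -ltNge => qhalf.
have [q1|q1] := ltP (q astar) 1; last first.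
  have /andP[_ q1'] := simplex_itv astar sq.
  by rewrite (_ : 1 - q astar = 0)//; lra.
have ka : k = astar.
  apply/eqP/negP => /negP kn.
  have := simplex_compl astar sq; rewrite (bigD1 k)//=.
  have := lk astar.
  have : 0 <= \sum_(i | (i != astar) && (i != k)) q i.
    by apply: sumr_ge0 => i _; exact: ltW (sq.1 i).
  lra.
have [b bn hb] := exists_large_follower sq q1.
apply: le_trans (increment_id_ge_gain (a := b) sq _); last by rewrite ka eqxx bn.
rewrite ler_pM2l//; have /andP[qb0 qb1] := simplex_itv b sq.
apply: gain_ge_linear hb qb1 => //; first by rewrite s0.
by rewrite divr_ge0 ?ltW// subr_gt0.
Qed.

(* Near 0 the condition [alpha -> 0] makes the second-order term of [1/p]
   negligible against its negative drift; away from 0 the term [- K p], whose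
   drift is bounded above by a multiple of [- gain], compensates. *)
Lemma inverse_increment_le0 : l x @[x --> 0^'+] --> 0 ->
  exists2 K, 0 <= K & forall q k, simplex q -> is_leader q k ->
    increment (fun x => x^-1 - K * x) q k <= 0.
Proof.
move=> l0; have hD := D0.
have [e e0 he] : exists2 e : R, 0 < e & forall x, 0 < x -> x < e -> l x <= D / 2.
  have /cvgrPdist_lt /(_ (D / 2)) := l0.
  move=> /(_ ltac:(lra)) [/= e e0 he]; exists e => // x x0 xe.
  have := he x; rewrite /= sub0r normrN gtr0_norm// => /(_ xe x0).
  by rewrite sub0r normrN => h; apply: le_trans (ler_norm _) (ltW h).
have N0 : 0 < #|A|%:R :> R by rewrite ltr0n; apply/card_gt0P; exists astar.
(* The first summand serves the case p >= e under another leader; the second serves [astar] leading,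
   where q astar >= 1 / #|A|. *)
pose K := 4 / (e ^+ 2 * D) + 4 * #|A|%:R ^+ 2 / D.
have K1 : 0 <= 4 / (e ^+ 2 * D) by rewrite divr_ge0// mulr_ge0 ?sqr_ge0// ltW.
have K2 : 0 <= 4 * #|A|%:R ^+ 2 / D :> R by rewrite divr_ge0 ?mulr_ge0 ?sqr_ge0// ltW.
have K0 : 0 <= K by exact: addr_ge0.
have KD : K * D = 4 / e ^+ 2 + 4 * #|A|%:R ^+ 2.
  by rewrite /K; field; rewrite !gt_eqF.
exists K => // q k sq lk.
have split h : increment (fun x => h x - K * x) q k =
    increment h q k - K * increment id q k.
  rewrite /increment mulr_sumr -sumrB; apply: eq_bigr => a _; ring.
rewrite split subr_le0 => {split}.
have qp a : 0 < q a := sq.1 a.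
have g0 a := simplex_gain_ge0 a sq.
have g1 a := simplex_gain_le a sq.
have p0 := qp astar.
(* Cost of a downward jump x / y: since the jump takes at most 3/4 of [q astar], the new value is at
   least a quarter of it, whence the factor 4. *)
have down y rho x : 0 < y -> 0 <= rho -> rho <= 1 -> 0 <= x ->
    x / y <= 3 / 4 * q astar ->
    y * rho * ((q astar - x / y)^-1 - (q astar)^-1) <= 4 * x / q astar ^+ 2.
  move=> y0 rho0 rho1 x0 xy.
  have d0 : 0 < q astar - x / y by lra.
  have -> : y * rho * ((q astar - x / y)^-1 - (q astar)^-1) =
      rho * x / (q astar * (q astar - x / y)).
    by field; rewrite !gt_eqF// -[q astar * y - x]/(q astar * y - x);
       rewrite (_ : q astar * y - x = (q astar - x / y) * y) ?mulr_gt0//; field; rewrite gt_eqF.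
  rewrite ler_pdivrMr ?mulr_gt0// mulrAC.
  rewrite ler_pdivlMr ?exprn_gt0//.
  apply: (le_trans (y := x * q astar ^+ 2)).
    by apply: ler_wpM2r; [exact: sqr_ge0|exact: ler_piMl].
  rewrite (_ : 4 * x * _ = x * (q astar * (4 * (q astar - x / y)))); last by ring.
  by apply: ler_wpM2l => //; rewrite expr2 ler_pM2l//; lra.
have [ka|kn] := eqVneq k astar.
  subst k; rewrite increment_leader// increment_id_leader// mulr_sumr.
  set S := \sum_(c | c != astar) _.
  have S0 : 0 <= S / q astar by apply: divr_ge0 (ltW p0); exact: sumr_ge0.
  have up : q astar * r astar * ((q astar + S / q astar)^-1 - (q astar)^-1) <= 0.
    apply: mulr_ge0_le0; first by apply: mulr_ge0 (ltW p0) _; case/andP: (r01 astar).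
    by rewrite subr_le0 lef_pV2 ?posrE ?lerDl// ltr_pwDl.
  rewrite -[leRHS]add0r; apply: lerD => //; apply: ler_sum => a an.
  have /andP[ra0 ra1] := r01 a.
  have N1 : 1 <= #|A|%:R * q astar.
    rewrite -[leLHS]sq.2 -sum_cst.
    by apply: ler_sum => c _; exact: lk.
  apply: (le_trans (down (q a) (r a) (gain l (q a)) _ ra0 ra1 _ _)) => //.
    rewrite ler_pdivrMr//; apply: (le_trans (g1 a)).
    have := lk a; have := qp a; nra.
  apply: (le_trans (y := K * (gain l (q a) * D))); last first.
    by apply: ler_wpM2l => //; apply: ler_wpM2l => //; exact: Dr.
  have -> : 4 * gain l (q a) / q astar ^+ 2 = gain l (q a) * (4 / q astar ^+ 2) by ring.
  rewrite [leRHS]mulrCA; apply: ler_wpM2l => //.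
  apply: (le_trans (y := 4 * #|A|%:R ^+ 2)); last first.
    by rewrite KD lerDr divr_ge0// sqr_ge0.
  rewrite ler_pdivrMr ?exprn_gt0// -mulrA -exprMn.
  by rewrite ler_peMr// exprn_ege1.
rewrite increment_follower// increment_id_follower//.
have /andP[ra0 ra1] := r01 astar; have /andP[rk0 rk1] := r01 k.
have pk := lk astar; have k0 := qp k.
have G0 := g0 astar; have G1 := g1 astar.
have DG := Dr kn.
have xk : gain l (q astar) / q k <= 3 / 4 * q astar.
  by rewrite ler_pdivrMr//; nra.
set G := gain l (q astar) in G0 G1 xk *; set p := q astar in p0 down pk G1 xk *.
have p20 : 0 < p ^+ 2 by rewrite exprn_gt0.
have up : p * r astar * ((p + G / p)^-1 - p^-1) = - (r astar * G / (p ^+ 2 + G)).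
  by field; rewrite -?expr2 !gt_eqF//; lra.
rewrite up.
have up0 : 0 <= r astar * G / (p ^+ 2 + G).
  by apply: divr_ge0; [exact: mulr_ge0|lra].
(* If 2 G <= D p^2, the drift of 1/p alone is nonpositive, by (r astar + r k) G <= (r astar - r k)
   p^2. Otherwise [gain_le] and the choice of [e] force p >= e, and the term in [K] compensates. *)
have [small|large] := leP (2 * G) (D * p ^+ 2); last first.
  have pe : e <= p.
    rewrite leNgt; apply/negP => pe.
    have h1 := gain_le lr (simplex_itv astar sq).
    have := he _ p0 pe; rewrite -/p -/G in h1 * => h2.
    have : l p * p ^+ 2 <= D / 2 * p ^+ 2 by apply: ler_wpM2r => //; exact: ltW.
    have : 0 <= l p * p ^+ 2.
      rewrite mulr_ge0 ?sqr_ge0//.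
      by case/andP: (lr.1 _ (simplex_itv astar sq)).
    lra.
  have h1 := down (q k) (r k) G k0 rk0 rk1 G0 xk.
  have : 4 * G / p ^+ 2 <= K * (G * (r astar - r k)).
    apply: (le_trans (y := K * (G * D))); last first.
      by apply: ler_wpM2l => //; apply: ler_wpM2l.
    have -> : 4 * G / p ^+ 2 = G * (4 / p ^+ 2) by ring.
    rewrite [leRHS]mulrCA; apply: ler_wpM2l => //.
    apply: (le_trans (y := 4 / e ^+ 2)).
      apply: ler_wpM2l => //; rewrite lef_pV2 ?posrE ?exprn_gt0//.
      by rewrite lerXn2r// nnegrE ltW.
    by rewrite KD lerDl mulr_ge0// sqr_ge0.
  lra.
have rhs : 0 <= K * (G * (r astar - r k)).
  by rewrite mulr_ge0// mulr_ge0//; lra.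
apply: le_trans rhs.
have d0 : 0 < p - G / q k by lra.
have -> : q k * r k * ((p - G / q k)^-1 - p^-1) = r k * G / (p * (p - G / q k)).
  field; rewrite !gt_eqF//.
  by rewrite (_ : p * q k - G = (p - G / q k) * q k) ?mulr_gt0//; field; rewrite gt_eqF.
have pG : 0 < p ^+ 2 - G by lra.
have : r k * G / (p * (p - G / q k)) <= r k * G / (p ^+ 2 - G).
  apply: ler_wpM2l; first exact: mulr_ge0.
  rewrite lef_pV2 ?posrE ?mulr_gt0// mulrBr -expr2 lerD2l lerN2.
  by rewrite mulrA ler_pdivrMr// mulrC; apply: ler_wpM2l.
have : r k * G / (p ^+ 2 - G) <= r astar * G / (p ^+ 2 + G).
  rewrite ler_pdivrMr// mulrAC ler_pdivlMr; last lra.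
  rewrite mulrAC [leRHS]mulrAC; apply: ler_wpM2r => //.
  have : (r astar + r k) * G <= 2 * G by apply: ler_wpM2r => //; lra.
  have : D * p ^+ 2 <= (r astar - r k) * p ^+ 2 by apply: ler_wpM2r => //; exact: ltW.
  lra.
lra.
Qed.

End Optimal.
End OneStep.

(** * Measurability of the choice of leader and arm *)

Section Selection.
Variables (R : realType) (A : finType).
Implicit Types (q : A -> R) (a k dflt : A).

(** The fibers of a monotone map are intervals. Both selection rules read a list at an index
    monotone in the uniform variable. *)
Lemma measurable_preimage_nat (f : R -> nat) (S : set nat) :
  (forall x y, x <= y -> (f x <= f y)%N) -> measurable (f @^-1` S).
Proof.
move=> fnd; rewrite (_ : f @^-1` S = \bigcup_(i in S) (f @^-1` [set i])).
  apply: bigcup_measurable => i _; apply: is_interval_measurable => x y /= fx fy z.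
  move=> /andP[xz zy]; apply/eqP.
  by rewrite eqn_leq; apply/andP; split; [rewrite -fy fnd|rewrite -fx fnd].
apply/seteqP; split=> x; first by move=> Sx; exists (f x).
by move=> [i Si fx]; rewrite /preimage/= fx.
Qed.

(** The clamp [minn] keeps the index inside the nonempty list of maximisers for every real [v], so
    no exceptional null set arises. *)
Lemma leader_is_leader dflt q v : is_leader q (leader dflt q v).
Proof.
rewrite /leader; set s := argmaxes q.
have s0 : (0 < size s)%N.
  rewrite -has_predT; apply/hasP; exists [arg max_(i > dflt) q i]%O => //.
  rewrite mem_filter mem_enum andbT.
  by case: arg_maxP => // i _ h; apply/forallP => b; exact: h.
have : nth dflt s (minn (truncn (v * (size s)%:R)) (size s).-1) \in s.
  apply: mem_nth; rewrite gtn_min; apply/orP; right.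
  by rewrite prednK.
by rewrite {1}/s mem_filter => /andP[/forallP].
Qed.

Lemma measurable_leader dflt q k : measurable [set v : R | leader dflt q v = k].
Proof.
rewrite /leader; set s := argmaxes q.
pose f (v : R) := minn (truncn (v * (size s)%:R)) (size s).-1.
apply: (@measurable_preimage_nat f [set i | nth dflt s i = k]) => x y xy.
rewrite /f leq_min geq_min geq_minr andbT le_truncn//.
by apply: ler_wpM2r.
Qed.

Lemma measurable_played dflt q a : measurable [set u : R | played dflt q u = a].
Proof.
rewrite /played; set s := enum A.
pose f (u : R) := find (fun k : nat => u < \sum_(b <- take k.+1 s) q b) (iota 0 (size s)).
apply: (@measurable_preimage_nat f [set i | nth dflt s i = a]) => x y xy.
by apply: sub_find => k /=; exact: le_lt_trans.
Qed.

End Selection.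

(** * Discrete expectations and the law of the played arm *)

Section Laws.
Variables (R : realType) (d : measure_display) (Omega : measurableType d).
Variable P : probability Omega R.

Lemma measurable_lt_set (x : R) : measurable [set y | y < x].
Proof. by rewrite (_ : [set y | y < x] = `]-oo, x[%classic). Qed.

Lemma measurable_le_set (x : R) : measurable [set y | y <= x].
Proof. by rewrite (_ : [set y | y <= x] = `]-oo, x]%classic). Qed.

Lemma EFin_probability E : measurable E -> (fine (P E))%:E = P E.
Proof. by move=> mE; rewrite fineK// fin_num_measure. Qed.

Lemma expectation_discrete (T : eqType) (Z : Omega -> T) (s : seq T) (f : T -> R) :
  uniq s -> (forall w, Z w \in s) -> (forall z, measurable [set w | Z w = z]) ->
  ('E_P[fun w => f (Z w)])%E = (\sum_(z <- s) fine (P [set w | Z w = z]) * f z)%:E.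
Proof.
move=> us Zs mZ; rewrite unlock.
have fE w : (f (Z w))%:E =
    \sum_(z <- s) ((f z)%:E * (\1_[set w | Z w = z] w)%:E)%E.
  rewrite (bigD1_seq (Z w))//= big1 ?adde0.
    by rewrite indicE mem_set// mule1.
  move=> z zw; rewrite indicE memNset ?mule0//= => /esym/eqP.
  exact/negP.
under eq_integral do rewrite fE.
have ii z : P.-integrable setT (fun w => (\1_[set w | Z w = z] w)%:E).
  exact: integrable_indic.
rewrite integral_sum//; last by move=> z; exact: integrableZl.
rewrite -sumEFin; apply: eq_bigr => z _.
by rewrite integralZl// integral_indic// setIT EFinM EFin_probability// muleC.
Qed.

Lemma sum_probability_fibers (A : finType) (Z : Omega -> A) :
  (forall z, measurable [set w | Z w = z]) ->
  \sum_z fine (P [set w | Z w = z]) = 1.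
Proof.
move=> mZ; have /= := @expectation_discrete _ Z (enum A) (fun=> 1) (enum_uniq A) _ mZ.
rewrite expectation_cst => /(_ (fun w => mem_enum A (Z w))) [].
by rewrite big_enum/= => e; rewrite [RHS]e; apply: eq_bigr => z _; rewrite mulr1.
Qed.

(** The distribution function is continuous: the strict event contains X <= x - e for every e > 0.
    Strict inequalities are what the half-open intervals of [played] require. *)
Lemma uniform01_lt (X : Omega -> R) x : measurable_fun setT X -> uniform01 P X ->
  0 <= x <= 1 -> fine (P [set w | X w < x]) = x.
Proof.
move=> mX uX /andP[x0 x1].
have mlt : measurable [set w | X w < x].
  rewrite -[X in measurable X]setTI; apply: (mX measurableT [set y | y < x]) => /=.
  exact: measurable_lt_set.
have mle y : measurable [set w | X w <= y].
  rewrite -[X in measurable X]setTI; apply: (mX measurableT [set z | z <= y]) => /=.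
  exact: measurable_le_set.
have PE y : fine (P [set w | X w <= y]) = Num.min (Num.max y 0) 1 by rewrite uX.
apply/eqP; rewrite eq_le; apply/andP; split.
  have xE : fine (P [set w | X w <= x]) = x by rewrite PE max_l// min_l.
  rewrite -[leRHS]xE; apply: fine_le; rewrite ?fin_num_measure//.
  by apply: le_measure; rewrite ?inE// => w /=; exact: ltW.
apply/ler_addgt0Pr => e e0; rewrite -lerBlDr.
apply: (le_trans (y := Num.min (Num.max (x - e) 0) 1)).
  by rewrite le_min le_max lexx/= lerBlDr (le_trans x1)// lerDl ltW.
rewrite -PE; apply: fine_le; rewrite ?fin_num_measure//.
apply: le_measure; rewrite ?inE// => w /= h.
by apply: (le_lt_trans h); rewrite ltrBlDr ltrDl.
Qed.

(** The interval of length [q a] is included in the event, which gives [q a] as a lower bound; both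
    families sum to 1, so all these bounds are equalities. Values of [X] outside [0, 1[ need no
    analysis. *)
Lemma probability_played (A : finType) dflt (q : A -> R) (X : Omega -> R) a :
  measurable_fun setT X -> uniform01 P X -> simplex q ->
  fine (P [set w | played dflt q (X w) = a]) = q a.
Proof.
move=> mX uX sq.
have mfib b : measurable [set w | played dflt q (X w) = b].
  rewrite -[X in measurable X]setTI.
  exact: (mX measurableT _ (measurable_played dflt q b)).
have ge b : q b <= fine (P [set w | played dflt q (X w) = b]).
  set s := enum A.
  pose S i := \sum_(c <- take i s) q c.
  have Sle i j : (i <= j)%N -> S i <= S j.
    move=> ij; rewrite /S -(cat_take_drop i (take j s)) take_takel// big_cat/=.
    by rewrite lerDl sumr_ge0// => c _; exact: ltW (sq.1 c).
  have S0 i : 0 <= S i by rewrite /S sumr_ge0// => c _; exact: ltW (sq.1 c).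
  have S1 i : S i <= 1.
    apply: (le_trans (y := S (maxn i (size s)))); first by rewrite Sle// leq_maxl.
    by rewrite /S take_oversize ?leq_maxr// big_enum/= sq.2.
  pose i := index b s.
  have bs : b \in s by rewrite mem_enum.
  have iz : (i < size s)%N by rewrite index_mem.
  have Sb : S i.+1 = S i + q b.
    by rewrite /S (take_nth b)// -cats1 big_cat big_seq1 nth_index.
  have mlt x : measurable [set w | X w < x].
    rewrite -[X in measurable X]setTI; apply: (mX measurableT [set y | y < x]) => /=.
    exact: measurable_lt_set.
  have -> : q b = fine (P ([set w | X w < S i.+1] `\` [set w | X w < S i])).
    rewrite measureD//; last by rewrite -ge0_fin_numE// fin_num_measure.
    rewrite setIidr; last by move=> w /= h; apply: (lt_le_trans h); exact: Sle.
    rewrite fineB ?fin_num_measure// !uniform01_lt ?S0 ?S1// Sb addrAC subrr add0r//.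
  rewrite fine_le ?fin_num_measure//; first exact: measurableD.
  apply: le_measure; rewrite ?inE//; first exact: measurableD.
  move=> w /= [lt1 /negP]; rewrite -leNgt => le0.
  (* Partial sums are nondecreasing, so on this interval the first one exceeding [X w] is that
     ending at [b]. *)
  rewrite /played -/s (_ : find _ _ = i) ?nth_index//.
  have h : has (fun k => X w < S k.+1) (iota 0 (size s)).
    by apply/hasP; exists i => //; rewrite mem_iota.
  apply/eqP; rewrite eqn_leq; apply/andP; split.
    rewrite leqNgt; apply/negP => /(before_find 0%N).
    by rewrite nth_iota// add0n lt1.
  rewrite leqNgt; apply/negP => lt.
  have := nth_find 0%N h; rewrite nth_iota; last by apply: ltn_trans iz.
  rewrite add0n ltNge => /negP; apply.
  by apply: le_trans le0; exact: Sle.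
apply/eqP; rewrite eq_le ge andbT.
have := sum_probability_fibers mfib; rewrite -sq.2 (bigD1 a)//= [RHS](bigD1 a)//=.
have : \sum_(i | i != a) q i <= \sum_(i | i != a) fine (P [set w | played dflt q (X w) = i]).
  by apply: ler_sum => b _.
lra.
Qed.

End Laws.

(** * The process as a function of finite words *)

Section History.
Variables (R : realType) (A : finType) (d : measure_display).
Variables (Omega : measurableType d) (P : probability Omega R).
Variables (l : R -> R) (r : A -> R) (astar : A) (p0 : A -> R).
Variables (Rw : A -> nat -> Omega -> R) (U V : nat -> Omega -> R).

Definition source (i : A * nat + nat + nat) : Omega -> R :=
  match i with
  | inl (inl (a, t)) => Rw a t
  | inl (inr t) => U t
  | inr t => V t
  end.

Hypotheses (lr : unit_rate l) (p0s : simplex p0).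
Hypotheses (rwB : forall a t, bernoulli_rv P (Rw a t) (r a))
           (unifU : forall t, uniform01 P (U t))
           (indep : mutual_indep P source).

(* leader, arm played, and the reward of every arm *)
Local Notation letter := (A * A * {ffun A -> bool})%type.

Implicit Types (q : A -> R) (x : letter) (h : seq letter) (t : nat) (w : Omega).

Definition apply_letter q x : A -> R :=
  samba_step l q x.1.1 x.1.2 (fun b => (x.2 b)%:R).

(* Histories list the most recent letter first. *)
Definition state h : A -> R := foldr (fun x q => apply_letter q x) p0 h.

Definition letter_at q t w : letter :=
  (leader astar q (V t w), played astar q (U t w), [ffun b => Rw b t w == 1]).

Fixpoint history t w : seq letter :=
  if t is t'.+1 then letter_at (state (history t' w)) t' w :: history t' w
  else [::].

Lemma apply_letterE q x : simplex q ->
  apply_letter q x = if x.2 x.1.2 then rewarded l q x.1.1 x.1.2 else q.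
Proof. exact: samba_stepE. Qed.

Lemma rewardE b t w : Rw b t w = (Rw b t w == 1)%:R.
Proof. by case: ((rwB b t).1 w) => ->; rewrite ?eqxx// eq_sym oner_eq0. Qed.

Lemma samba_history t w : samba astar l p0 Rw U V t w = state (history t w).
Proof.
elim: t => //= t ->; rewrite /apply_letter/=; congr (samba_step _ _ _ _ _).
by apply/funext => b; rewrite ffunE; exact: rewardE.
Qed.

Lemma simplex_state t w : simplex (state (history t w)).
Proof.
elim: t => //= t ih; rewrite apply_letterE//; case: ifPn => // _.
by apply: simplex_rewarded => //; exact: leader_is_leader.
Qed.

Lemma size_history t w : size (history t w) = t.
Proof. by elim: t => //= t ->. Qed.

Lemma history_drop s t w : (s <= t)%N -> history s w = drop (t - s) (history t w).
Proof.
move=> /subnK <-; rewrite addnK; elim: (t - s)%N => [|k ih]; first by rewrite drop0.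
by rewrite addSn.
Qed.

(** A list, because [mutual_indep] quantifies over duplicate-free sequences; concatenation later
    splits its product into present and past. *)
Definition sources t : seq (A * nat + nat + nat) :=
  inr t :: inl (inr t) :: [seq inl (inl (b, t)) | b <- enum A].

Fixpoint sources_before t : seq (A * nat + nat + nat) :=
  if t is t'.+1 then sources t' ++ sources_before t' else [::].
Arguments sources_before : simpl never.

Lemma sources_beforeS t : sources_before t.+1 = sources t ++ sources_before t.
Proof. by []. Qed.

Definition source_time (i : A * nat + nat + nat) : nat :=
  match i with
  | inl (inl (_, t)) => t
  | inl (inr t) => t
  | inr t => t
  end.

Lemma sources_time t i : (i \in sources t) = (source_time i == t).
Proof.
rewrite /sources !inE; set s := map _ _.
have rwE b u : (inl (inl (b, u)) \in s) = (u == t).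
  apply/mapP/eqP => [[c _ [_ ->]]//|->]; by exists b => //; rewrite mem_enum.
have uE u : inl (inr u) \notin s by apply/mapP => -[].
have vE u : inr u \notin s by apply/mapP => -[].
case: i => [[[b u]|u]|u] /=; first by rewrite rwE.
  by rewrite (negbTE (uE u)) orbF.
by rewrite (negbTE (vE u)) orbF.
Qed.

Lemma sources_before_time t i : (i \in sources_before t) = (source_time i < t)%N.
Proof.
elim: t => // t ih; rewrite sources_beforeS mem_cat sources_time ih ltnS.
by rewrite [RHS]leq_eqVlt.
Qed.

Lemma uniq_sources_before t : uniq (sources_before t).
Proof.
elim: t => // t ih; rewrite sources_beforeS cat_uniq ih andbT.
apply/andP; split; last first.
  apply/hasPn => i; rewrite sources_before_time /= => lt; apply/negP.
  by rewrite sources_time => /eqP e; rewrite e ltnn in lt.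
rewrite /sources /= !inE/= map_inj_uniq ?enum_uniq ?andbT; last by move=> b c [].
by apply/andP; split; apply/mapP => -[].
Qed.

Definition letter_set q x (i : A * nat + nat + nat) : set R :=
  match i with
  | inl (inl (b, _)) => if x.2 b then [set 1] else ~` [set 1]
  | inl (inr _) => [set u | played astar q u = x.1.2]
  | inr _ => [set v | leader astar q v = x.1.1]
  end.

Lemma measurable_letter_set q x i : measurable (letter_set q x i).
Proof.
case: i => [[[b s]|s]|s] /=.
- by case: ifP => _ //; exact: measurableC.
- exact: measurable_played.
- exact: measurable_leader.
Qed.

Lemma letter_atP q t x w : letter_at q t w = x <->
  (forall i, i \in sources t -> letter_set q x i (source i w)).
Proof.
split=> [<- i|h].
  rewrite sources_time; case: i => [[[b s]|s]|s] /= /eqP -> //=.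
  by rewrite ffunE; case: eqP.
case: x h => [[k a] rho] h; congr (_, _, _).
- by apply: (h (inr t)); rewrite sources_time/=.
- by apply: (h (inl (inr t))); rewrite sources_time/=.
- apply/ffunP => b; rewrite ffunE.
  have := h (inl (inl (b, t))); rewrite sources_time/= eqxx => /(_ isT).
  by case: (rho b) => /=; move/eqP; [|move/negbTE].
Qed.

Definition letter_probability t q x : R :=
  fine (P [set w | leader astar q (V t w) = x.1.1]) *
  fine (P [set w | played astar q (U t w) = x.1.2]) *
  \prod_b (if x.2 b then r b else 1 - r b).

Lemma measurable_source i B : measurable B -> measurable (source i @^-1` B).
Proof.
move=> mB; rewrite -[X in measurable X]setTI.
exact: (indep.1 i measurableT).
Qed.

Definition extend_sets t q x (B : A * nat + nat + nat -> set R) i : set R :=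
  if source_time i == t then letter_set q x i else B i.

(** Once the past word is fixed the state is deterministic, so the next letter constrains each
    source of time [t] separately, by sets depending on [h] only. *)
Lemma history_cons_cylinder t x h B :
  [set w | history t w = h] =
    \bigcap_(i in [set i | i \in sources_before t]) (source i @^-1` B i) ->
  [set w | history t.+1 w = x :: h] =
    \bigcap_(i in [set i | i \in sources_before t.+1])
      (source i @^-1` extend_sets t (state h) x B i).
Proof.
move=> hB; apply/seteqP; split=> w /=.
  move=> [lx hh] i /=; rewrite sources_beforeS mem_cat sources_time /preimage/= /extend_sets.
  case: eqP => [ti _|_ /=].
    move: lx; rewrite hh => /letter_atP; apply.
    by rewrite sources_time ti.
  by move=> it; have : [set w | history t w = h] w by []; rewrite hB; apply.
move=> H.
have hh : history t w = h.
  suff : [set w | history t w = h] w by [].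
  rewrite hB => i /= it; have := H i; rewrite /= sources_beforeS mem_cat it orbT => /(_ isT).
  by move: it; rewrite sources_before_time /preimage/= /extend_sets => /ltn_eqF ->.
rewrite hh; congr (_ :: _); apply/letter_atP => i it.
have := H i; rewrite /= sources_beforeS mem_cat it => /(_ isT).
by move: it; rewrite sources_time /preimage/= /extend_sets => ->.
Qed.

Lemma history_cylinder t h : size h = t -> exists2 B,
  (forall i, measurable (B i)) &
  [set w | history t w = h] =
  \bigcap_(i in [set i | i \in sources_before t]) (source i @^-1` B i).
Proof.
elim: t h => [|t ih] [|x h] //=.
  move=> _; exists (fun=> setT) => //.
  by rewrite (_ : [set w | [::] = [::]] = setT)//; apply/seteqP; split.
move=> [/ih[B mB hB]]; exists (extend_sets t (state h) x B).
  by move=> i; rewrite /extend_sets; case: ifP => // _; exact: measurable_letter_set.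
exact: history_cons_cylinder.
Qed.

Lemma measurable_history t h : measurable [set w | history t w = h].
Proof.
have [st|st] := eqVneq (size h) t.
  have [B mB ->] := history_cylinder st.
  apply: fin_bigcap_measurable => [|i _]; last exact: measurable_source.
  exact: finite_seq.
rewrite (_ : [set w | _] = set0)//; apply/seteqP; split => // w /= e.
by move: st; rewrite -e size_history eqxx.
Qed.

Lemma probability_reward b t x :
  P (Rw b t @^-1` (if x.2 b then [set 1] else ~` [set 1])) =
  (if x.2 b then r b else 1 - r b)%:E.
Proof.
have [_ rw1] := rwB b t; case: ifP => _; first exact: rw1.
rewrite -preimage_setC probability_setC.
  by rewrite (_ : Rw b t @^-1` [set 1] = [set w | Rw b t w = 1])// rw1.
exact: (measurable_source (inl (inl (b, t)))).
Qed.

(** Independence applies to both cylinders: the earlier sources give back the probability of [h],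
    and those of time [t] give the kernel. *)
Lemma probability_history_cons t x h : size h = t ->
  P [set w | history t.+1 w = x :: h] =
  ((letter_probability t (state h) x)%:E * P [set w | history t w = h])%E.
Proof.
move=> st; have [B mB hB] := history_cylinder st.
have mB' i : measurable (extend_sets t (state h) x B i).
  by rewrite /extend_sets; case: ifP => // _; exact: measurable_letter_set.
rewrite (history_cons_cylinder x hB) hB !indep.2 ?uniq_sources_before//.
rewrite big_cat/=; congr (_ * _)%E; last first.
  rewrite big_seq [RHS]big_seq; apply: eq_bigr => i.
  by rewrite sources_before_time /extend_sets => /ltn_eqF ->.
rewrite /sources !big_cons big_map /extend_sets /= eqxx.
rewrite /letter_probability !EFinM !EFin_probability.
- rewrite muleA; congr (_ * _)%E; rewrite -prodEFin big_enum/=.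
  by apply: eq_bigr => b _; rewrite ?eqxx -(probability_reward b t x).
- exact: (measurable_source (inl (inr t)) (measurable_played _ _ _)).
- exact: (measurable_source (inr t) (measurable_leader _ _ _)).
Qed.

(** * Expectations as finite sums over words *)

Fixpoint words t : seq (seq letter) :=
  if t is t'.+1 then [seq x :: h | h <- words t', x <- enum {: letter}] else [:: [::]].

Lemma wordsS t : words t.+1 = [seq x :: h | h <- words t, x <- enum {: letter}].
Proof. by []. Qed.

Lemma size_words t h : h \in words t -> size h = t.
Proof.
elim: t h => [|t ih] h /=; first by rewrite inE => /eqP ->.
by move=> /allpairsP[[h' x] /= [h't _ ->]] /=; rewrite (ih _ h't).
Qed.

Lemma history_words t w : history t w \in words t.
Proof.
elim: t => [|t ih] /=; first by rewrite inE.
by apply/allpairsP; exists (history t w, letter_at (state (history t w)) t w);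
  rewrite /= ih mem_enum.
Qed.

Lemma uniq_words t : uniq (words t).
Proof.
elim: t => //= t ih; apply: allpairs_uniq => //; first exact: enum_uniq.
by move=> [h x] [h' x'] _ _ /= [-> ->].
Qed.

(** As a finite sum it is linear and monotone without integrability conditions. *)
Definition mean t (f : seq letter -> R) : R :=
  \sum_(h <- words t) fine (P [set w | history t w = h]) * f h.

Lemma expectation_history t f :
  ('E_P[fun w => f (history t w)])%E = (mean t f)%:E.
Proof.
apply: expectation_discrete; [exact: uniq_words|exact: history_words|].
exact: measurable_history.
Qed.

Lemma measurable_history_pred t (S : seq letter -> Prop) :
  measurable [set w | S (history t w)].
Proof.
rewrite (_ : [set w | _] =
  \bigcup_(h in [set h | h \in words t /\ S h]) [set w | history t w = h]).
  apply: fin_bigcup_measurable => [|h _]; last exact: measurable_history.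
  apply: (sub_finite_set (B := [set h | h \in words t])); first by move=> h /= [].
  exact: finite_seq.
apply/seteqP; split=> w /=; last by move=> [h [_ Sh]] ->.
by move=> Sw; exists (history t w) => //; split=> //; exact: history_words.
Qed.

Lemma probability_history t (S : seq letter -> Prop) :
  P [set w | S (history t w)] = (mean t (fun h => (`[< S h >])%:R))%:E.
Proof.
rewrite -expectation_history -expectation_indic; last exact: measurable_history_pred.
congr expectation; by apply/funext => w; rewrite indicE.
Qed.

Lemma meanS t f : mean t.+1 f =
  mean t (fun h => \sum_x letter_probability t (state h) x * f (x :: h)).
Proof.
rewrite /mean wordsS big_allpairs_dep big_seq [RHS]big_seq; apply: eq_bigr => h ht.
rewrite big_enum mulr_sumr; apply: eq_bigr => x _.
rewrite (probability_history_cons _ (size_words ht)) fineM ?fin_num_measure//=.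
  by ring.
exact: measurable_history.
Qed.

Lemma mean0 f : mean 0 f = f [::].
Proof.
rewrite /mean big_seq1 (_ : [set w | _] = setT) ?probability_setT ?mul1r//.
by apply/seteqP; split.
Qed.

(** Words that no outcome realises have probability 0, and realised ones have their state in the
    simplex, so the comparison is needed only there. *)
Lemma ler_mean t f g :
  (forall h, simplex (state h) -> f h <= g h) -> mean t f <= mean t g.
Proof.
move=> fg; apply: ler_sum => h _.
have [[w hw]|nw] := pselect (exists w, history t w = h).
  apply: ler_wpM2l; last by apply: fg; rewrite -hw; exact: simplex_state.
  by rewrite fine_ge0.
rewrite (_ : [set w | _] = set0) ?measure0/= ?mul0r//.
by apply/seteqP; split => // w hw; apply: nw; exists w.
Qed.

Lemma eq_mean t f g :
  (forall h, simplex (state h) -> f h = g h) -> mean t f = mean t g.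
Proof.
by move=> fg; apply/eqP; rewrite eq_le; apply/andP; split; apply: ler_mean => h /fg ->.
Qed.

Lemma meanD t f g : mean t (fun h => f h + g h) = mean t f + mean t g.
Proof. by rewrite /mean -big_split; apply: eq_bigr => h _; rewrite mulrDr. Qed.

Lemma meanZ t c f : mean t (fun h => c * f h) = c * mean t f.
Proof. by rewrite /mean mulr_sumr; apply: eq_bigr => h _; ring. Qed.

Lemma mean_cst t c : mean t (fun=> c) = c.
Proof.
have := expectation_history t (fun=> c); rewrite expectation_cst.
by case.
Qed.

Lemma sum_leader_probability t q :
  \sum_k fine (P [set w | leader astar q (V t w) = k]) = 1.
Proof.
apply: sum_probability_fibers => k.
exact: (measurable_source (inr t) (measurable_leader _ _ _)).
Qed.

(** Distributing the product over the arms, every factor other than that of [a] sums to 1. *)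
Lemma sum_reward_probability a (g c : R) :
  \sum_(rho : {ffun A -> bool})
    (\prod_b (if rho b then r b else 1 - r b)) * (if rho a then g else c) =
  r a * g + (1 - r a) * c.
Proof.
pose F b (beta : bool) := (if beta then r b else 1 - r b) *
  (if b == a then (if beta then g else c) else 1).
rewrite (eq_bigr (fun rho : {ffun A -> bool} => \prod_b F b (rho b))); last first.
  move=> rho _; rewrite big_split/=; congr (_ * _).
  rewrite (bigD1 a)//= eqxx big1 ?mulr1// => b ba; by rewrite (negbTE ba).
rewrite -(bigA_distr_bigA F) (eq_bigr (fun b => F b true + F b false)); last first.
  by move=> b _; rewrite big_bool.
rewrite (bigD1 a)//= big1 ?mulr1; first by rewrite /F eqxx.
by move=> b ba; rewrite /F (negbTE ba); ring.
Qed.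

(** Rewards are averaged out first, then the played arm has law [q]. Isolating the unrewarded value
    [c] makes the remainder an average increment. *)
Lemma sum_letter_probability t q (G : A -> A -> R) c : simplex q ->
  \sum_x letter_probability t q x * (if x.2 x.1.2 then G x.1.1 x.1.2 else c) =
  c + \sum_k fine (P [set w | leader astar q (V t w) = k]) *
        \sum_a q a * r a * (G k a - c).
Proof.
move=> sq; set pl := fun k => fine (P [set w | leader astar q (V t w) = k]).
have pp a : fine (P [set w | played astar q (U t w) = a]) = q a.
  by apply: probability_played => //; exact: (indep.1 (inl (inr t))).
transitivity (\sum_k \sum_a pl k * q a * (r a * G k a + (1 - r a) * c)).
  rewrite pair_bigA/= -(pair_bigA _ (fun ka (rho : {ffun A -> bool}) =>
    letter_probability t q (ka, rho) *
      (if rho ka.2 then G ka.1 ka.2 else c)))/=.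
  apply: eq_bigr => -[k a] _ /=; rewrite -sum_reward_probability mulr_sumr.
  by apply: eq_bigr => rho _; rewrite /letter_probability/= pp mulrA.
have -> : c = \sum_k pl k * \sum_a q a * c.
  by rewrite -mulr_suml sum_leader_probability mul1r -mulr_suml sq.2 mul1r.
rewrite -big_split/=; apply: eq_bigr => k _.
rewrite -/(pl k) -mulrDr -big_split/= mulr_sumr; apply: eq_bigr => a _.
rewrite -[\sum_k _](_ : c = _); last first.
  by rewrite -mulr_suml sum_leader_probability mul1r -mulr_suml sq.2 mul1r.
ring.
Qed.

Lemma mean_step t (g : (A -> R) -> R) :
  mean t.+1 (fun h => g (state h)) =
  mean t (fun h => g (state h) +
    \sum_k fine (P [set w | leader astar (state h) (V t w) = k]) *
      \sum_a state h a * r a * (g (rewarded l (state h) k a) - g (state h))).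
Proof.
rewrite meanS; apply: eq_mean => h sh /=.
rewrite -(@sum_letter_probability t _ (fun k a => g (rewarded l (state h) k a)))//.
by apply: eq_bigr => x _; rewrite apply_letterE//; case: ifP.
Qed.

(** The tie-breaking law is never computed: it suffices that it has mass 1 and is carried by
    maximisers. *)
Lemma leader_mean_ge t q (f : A -> R) c : (forall k, is_leader q k -> c <= f k) ->
  c <= \sum_k fine (P [set w | leader astar q (V t w) = k]) * f k.
Proof.
move=> cf; rewrite -[leLHS]mul1r -(sum_leader_probability t q) mulr_suml.
apply: ler_sum => k _; have [[w <-]|nw] := pselect (exists w, leader astar q (V t w) = k).
  by apply: ler_wpM2l; [rewrite fine_ge0|apply: cf; exact: leader_is_leader].
rewrite (_ : [set w | _] = set0) ?measure0/= ?mul0r//.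
by apply/seteqP; split => // w hw; apply: nw; exists w.
Qed.

(** Any event of the history up to [t] that fixes the state at [xs t] is multiplied by the same
    factor [kappa (xs t)] when the next state is prescribed. Applying this to the whole past and to
    the present alone yields the identity. *)
Lemma markov_samba : markov_chain P (samba astar l p0 Rw U V).
Proof.
move=> t xs y H.
pose kappa q := \sum_x letter_probability t q x * (`[< apply_letter q x = y >])%:R.
have key (S : seq letter -> Prop) : (forall h, S h -> state h = xs t) ->
    P ([set w | S (history t w)] `&` [set w | samba astar l p0 Rw U V t.+1 w = y]) =
    ((kappa (xs t))%:E * P [set w | S (history t w)])%E.
  move=> Sx.
  pose S' h := S (behead h) /\ state h = y.
  rewrite (_ : _ `&` _ = [set w | S' (history t.+1 w)]); last first.
    apply/seteqP; split => w [Sw yw]; split => //.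
      by rewrite -samba_history.
    by rewrite /mkset samba_history.
  rewrite (probability_history t.+1 S') probability_history meanS -EFinM -meanZ.
  congr EFin; apply: eq_mean => h _ /=.
  have [Sh|nSh] := pselect (S h); last first.
    rewrite (asboolF nSh) mulr0 big1// => x _.
    by rewrite asboolF ?mulr0// => -[].
  rewrite (asboolT Sh) mulr1 -(Sx h Sh); apply: eq_bigr => x _; congr (_ * _%:R).
  by congr nat_of_bool; apply/asboolP/asboolP => [[]|].
pose past h := forall s, (s <= t)%N -> state (drop (t - s) h) = xs s.
have HE : H = [set w | past (history t w)].
  apply/seteqP; split=> w /= Hw s st.
    by rewrite -history_drop// -samba_history; apply: Hw; rewrite /= ltnS.
  by rewrite /= samba_history (history_drop w (t := t))//; apply: Hw.
pose present h := state h = xs t.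
have tE : [set w | samba astar l p0 Rw U V t w = xs t] =
    [set w | present (history t w)].
  by apply/seteqP; split=> w; rewrite /present /= samba_history.
rewrite HE tE (key past) ?(key present)//.
  by rewrite muleAC muleC.
by move=> h /(_ t (leqnn t)); rewrite subnn drop0.
Qed.

Lemma state_ge t w : state (history t w) astar / 4 <= state (history t.+1 w) astar.
Proof.
have st := simplex_state t w.
rewrite /= apply_letterE//; case: ifPn => _; last by have := st.1 astar; lra.
by apply: rewarded_ge => //; exact: leader_is_leader.
Qed.

(** * Expected reward and the regret bound by suboptimality *)

Lemma mean_reward T : mean T (fun h => \sum_(x <- h) (x.2 x.1.2)%:R) =
  \sum_(t < T) mean t (fun h => \sum_a state h a * r a).
Proof.
elim: T => [|T ih]; first by rewrite mean0 big_nil big_ord0.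
rewrite big_ord_recr/= -ih -meanD meanS; apply: eq_mean => h sh.
rewrite (eq_bigr (fun x => letter_probability T (state h) x *
  (if x.2 x.1.2 then 1 + \sum_(y <- h) (y.2 y.1.2)%:R
   else \sum_(y <- h) (y.2 y.1.2)%:R))); last first.
  by move=> x _; rewrite big_cons; case: ifP => _; rewrite ?add0r.
rewrite (@sum_letter_probability T _ (fun _ _ => _))//; congr (_ + _).
rewrite -mulr_suml sum_leader_probability mul1r; apply: eq_bigr => a _.
by rewrite addrK mulr1.
Qed.

Lemma expected_reward T :
  ('E_P[fun w => (\sum_(t < T) \sum_a
     (played astar (samba astar l p0 Rw U V t w) (U t w) == a)%:R * Rw a t w)%R])%E =
  (\sum_(t < T) mean t (fun h => \sum_a state h a * r a))%:E.
Proof.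
rewrite -mean_reward -expectation_history; congr expectation.
apply/funext => w; elim: T => [|T ih]; first by rewrite big_ord0 big_nil.
rewrite big_ord_recr/= ih big_cons/= addrC ffunE -samba_history; congr (_ + _).
rewrite (bigD1 (played astar (samba astar l p0 Rw U V T w) (U T w)))//= eqxx mul1r.
rewrite -rewardE big1 ?addr0// => a; rewrite eq_sym => /negbTE ->.
by rewrite mul0r.
Qed.

Definition suboptimality t : R := mean t (fun h => 1 - state h astar).

Definition trailing t : R := mean t (fun h => (state h astar <= 2^-1)%R%:R).

(** A play of a suboptimal arm costs at most 1 because mean rewards lie in [0, 1], and its
    conditional probability is [1 - p_astar(t)]. *)
Lemma regret_le T : (forall a, 0 <= r a <= 1) ->
  ((r astar * T%:R)%:E - 'E_P[fun w => (\sum_(t < T) \sum_a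
     (played astar (samba astar l p0 Rw U V t w) (U t w) == a)%:R * Rw a t w)%R]
   <= (\sum_(t < T) suboptimality t)%:E)%E.
Proof.
move=> r01; rewrite expected_reward -EFinB lee_fin.
have -> : r astar * T%:R = \sum_(t < T) r astar by rewrite sumr_const card_ord mulr_natr.
rewrite -sumrB; apply: ler_sum => t _.
rewrite lerBlDr /suboptimality -meanD -[leLHS](mean_cst t); apply: ler_mean => h sh.
rewrite (bigD1 astar)//= -(simplex_compl astar sh) addrCA -big_split/=.
have /andP[ra0 ra1] := r01 astar; have sc := simplex_compl astar sh.
have : \sum_(a | a != astar) state h a * r astar <=
    \sum_(a | a != astar) (state h a + state h a * r a).
  apply: ler_sum => a _; have /andP[b0 b1] := r01 a; have := sh.1 a; nra.
rewrite -mulr_suml sc; nra.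
Qed.

(** * Drift in expectation, almost sure convergence and regret rate *)

Section Drift.
Variable D : R.
Hypotheses (r01 : forall a, 0 <= r a <= 1) (D0 : 0 < D)
           (Dr : forall a, a != astar -> D <= r astar - r a).
Hypothesis lpos : forall x : R, 0 < x <= 1 -> 0 < l x.

Lemma mean_increment t (g : R -> R) :
  mean t.+1 (fun h => g (state h astar)) = mean t (fun h => g (state h astar) +
    \sum_k fine (P [set w | leader astar (state h) (V t w) = k]) *
      increment l r astar g (state h) k).
Proof. exact: (mean_step t (fun q => g (q astar))). Qed.

Lemma mean_optimal_ge t (c : (A -> R) -> R) :
  (forall q k, simplex q -> is_leader q k -> c q <= increment l r astar id q k) ->
  mean t (fun h => state h astar) + mean t (fun h => c (state h)) <=
  mean t.+1 (fun h => state h astar).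
Proof.
move=> cinc; rewrite (mean_increment t id) -meanD; apply: ler_mean => h sh.
by rewrite lerD2l; apply: leader_mean_ge => k; exact: cinc.
Qed.

Lemma suboptimalityE t : suboptimality t = 1 - mean t (fun h => state h astar).
Proof.
rewrite /suboptimality -[in RHS](mean_cst t 1) -[in RHS]mulN1r -meanZ -meanD.
by apply: eq_mean => h _; rewrite mulN1r.
Qed.

Lemma suboptimality_itv t : 0 <= suboptimality t <= 1.
Proof.
apply/andP; split.
  rewrite -(mean_cst t 0); apply: ler_mean => h sh.
  by rewrite subr_ge0; case/andP: (simplex_itv astar sh).
rewrite -[leRHS](mean_cst t 1); apply: ler_mean => h sh.
by rewrite gerBl; case/andP: (simplex_itv astar sh).
Qed.

Lemma trailing_ge0 t : 0 <= trailing t.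
Proof. by rewrite -(mean_cst t 0); apply: ler_mean. Qed.

Lemma suboptimality_nonincreasing t : suboptimality t.+1 <= suboptimality t.
Proof.
rewrite !suboptimalityE.
have /(mean_optimal_ge t) : forall q k, simplex q -> is_leader q k ->
    0 <= increment l r astar id q k.
  by move=> q k sq _; exact: (increment_id_ge0 lr D0 Dr).
rewrite mean_cst; lra.
Qed.

(** The conditional bound is first weakened to an expression affine in [1 - p_astar] and in the
    indicator of p_astar <= 1/2; its mean is then the same expression in [suboptimality] and
    [trailing]. *)
Lemma suboptimality_drift t s c : 0 <= s <= 1 -> 0 <= c ->
  D * (l s / 4 * (2 * ((suboptimality t - trailing t) / #|A|%:R - s) * c - c ^+ 2))
  <= suboptimality t - suboptimality t.+1.
Proof.
move=> s01 c0; rewrite (suboptimalityE t.+1) {2}suboptimalityE.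
have N0 : 0 < #|A|%:R :> R by rewrite ltr0n; apply/card_gt0P; exists astar.
have ls0 : 0 <= l s by case/andP: (lr.1 _ s01).
pose f (q : A -> R) := D * (l s / 4 *
  (2 * ((1 - q astar - (q astar <= 2^-1)%R%:R) / #|A|%:R - s) * c - c ^+ 2)).
have /(mean_optimal_ge t) : forall q k, simplex q -> is_leader q k ->
    f q <= increment l r astar id q k.
  move=> q k sq lk; apply: le_trans (increment_id_ge_linear lr D0 Dr sq lk s01 c0).
  rewrite /f ler_pM2l//; apply: ler_wpM2l; first by rewrite divr_ge0.
  rewrite lerD2r; apply: ler_wpM2r => //; rewrite ler_pM2l// lerD2r ler_pM2r ?invr_gt0//.
  case: ifPn => _ /=; last by rewrite subr0.
  have := sq.1 astar; lra.
rewrite (@eq_mean t (fun h => f (state h)) (fun h =>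
    D * (l s / 4 * (2 * c / #|A|%:R)) * (1 - state h astar) +
    - (D * (l s / 4 * (2 * c / #|A|%:R))) * (state h astar <= 2^-1)%R%:R +
    D * (l s / 4 * (- 2 * s * c - c ^+ 2)))); last by move=> h _; rewrite /f; ring.
rewrite !meanD !meanZ mean_cst -/(suboptimality t) -/(trailing t).
set a := #|A|%:R^-1.
have -> : D * (l s / 4 * (2 * c * a)) * suboptimality t +
  - (D * (l s / 4 * (2 * c * a))) * trailing t +
  D * (l s / 4 * (- 2 * s * c - c ^+ 2)) =
  D * (l s / 4 * (2 * ((suboptimality t - trailing t) * a - s) * c - c ^+ 2)) by ring.
lra.
Qed.

(** The mean of the supermartingale 1/p - K p never exceeds 1 / p0; adding back K p costs at most
    [K]. *)
Lemma mean_inverse_bounded : l x @[x --> 0^'+] --> 0 ->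
  exists2 M, 0 <= M & forall t, mean t (fun h => (state h astar)^-1) <= M.
Proof.
move=> l0; have [K K0 hK] := inverse_increment_le0 lr r01 D0 Dr l0.
exists ((p0 astar)^-1 + K).
  by rewrite addr_ge0// invr_ge0 ltW// p0s.1.
pose g := fun x : R => x^-1 - K * x.
have g_le t : mean t (fun h => g (state h astar)) <= (p0 astar)^-1.
  elim: t => [|t ih].
    by rewrite mean0 /g/= gerBl; apply: mulr_ge0 => //; exact: ltW (p0s.1 astar).
  apply: le_trans ih; rewrite mean_increment; apply: ler_mean => h sh.
  rewrite gerDl -oppr_ge0 -sumrN.
  rewrite (eq_bigr (fun k => fine (P [set w | leader astar (state h) (V t w) = k]) *
    - increment l r astar g (state h) k)); last by move=> k _; rewrite mulrN.
  by apply: leader_mean_ge => k lk; rewrite oppr_ge0; exact: hK.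
move=> t; apply: (le_trans (y := mean t (fun h => g (state h astar) + K))).
  apply: ler_mean => h sh; rewrite /g -addrA lerDl -[X in - _ + X]mulr1.
  rewrite -[X in X + _]mulrN -mulrDr mulr_ge0//.
  by have /andP[_] := simplex_itv astar sh; lra.
by rewrite meanD mean_cst lerD2r.
Qed.

Definition undecided eta : nat -> set Omega := fun t =>
  [set w | (fun h => eta <= state h astar /\
                     eta <= (1 - state h astar) / #|A|%:R) (history t w)].

(** Each undecided time adds at least [c] times its probability to the mean of p_astar. These
    increments telescope to at most 1, so the probabilities are summable and Borel-Cantelli
    applies. *)
Lemma undecided_limsup eta : 0 < eta <= 1 -> P (lim_sup_set (undecided eta)) = 0%E.
Proof.
move=> /andP[e0 e1].
have lp : 0 < l (eta / 2) by apply: lpos; apply/andP; split; lra.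
set c := D * (l (eta / 2) * (eta / 2) ^+ 2 / 4).
have c0 : 0 < c by rewrite /c !(mulr_gt0, invr_gt0, exprn_gt0)//; lra.
pose S h := eta <= state h astar /\ eta <= (1 - state h astar) / #|A|%:R.
have inc t : c * mean t (fun h => (`[< S h >])%:R) <=
    mean t.+1 (fun h => state h astar) - mean t (fun h => state h astar).
  rewrite lerBrDl -meanZ.
  apply: (mean_optimal_ge t (c := fun q => c * (`[< eta <= q astar /\
    eta <= (1 - q astar) / #|A|%:R >])%:R)) => q k sq lk.
  case: asboolP => [[h1 h2]|_]; rewrite ?mulr1 ?mulr0.
    exact: (increment_id_ge lr D0 Dr).
  exact: (increment_id_ge0 lr D0 Dr).
have part n : c * \sum_(t < n) mean t (fun h => (`[< S h >])%:R) <= 1.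
  rewrite mulr_sumr; apply: (le_trans (y := \sum_(t < n)
      (mean t.+1 (fun h => state h astar) - mean t (fun h => state h astar)))).
    by apply: ler_sum => t _; exact: inc.
  rewrite -(big_mkord xpredT (fun t => mean t.+1 (fun h => state h astar)
    - mean t (fun h => state h astar))) telescope_sumr//.
  have := suboptimality_itv n; have := suboptimality_itv 0.
  rewrite !suboptimalityE; lra.
apply: lim_sup_set_cvg0; first by move=> t; exact: measurable_history_pred.
apply: (@le_lt_trans _ _ (c^-1)%:E); last exact: ltry.
apply: lime_le; first by apply: is_cvg_nneseries.
apply: nearW => n; rewrite big_mkord.
rewrite (eq_bigr (fun t : 'I_n => (mean t (fun h => (`[< S h >])%:R))%:E)); last first.
  by move=> t _; exact: (probability_history t S).
by rewrite sumEFin lee_fin -[leRHS]mul1r ler_pdivlMr// mulrC; exact: part.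
Qed.

Definition vanishing : set Omega := [set w | forall j : nat, exists n : nat,
  forall t, (n <= t)%N -> state (history t w) astar <= j.+1%:R^-1].

(** Markov's inequality for 1/p_astar gives P(p_astar(t) <= 1/(j+1)) <= M / (j+1) uniformly in t.
    Staying below this level from time [n] on is an event increasing in [n], so the union keeps the
    bound, and [j] is arbitrary. *)
Lemma vanishing_negligible : l x @[x --> 0^'+] --> 0 -> P.-negligible vanishing.
Proof.
move=> l0; have [M M0 hM] := mean_inverse_bounded l0.
pose below (j : nat) h : Prop := state h astar <= j.+1%:R^-1.
have mbelow j t : measurable [set w | below j (history t w)].
  exact: (measurable_history_pred t (below j)).
pose low (j n : nat) := \bigcap_t [set w | below j (history (n + t) w)].
have mlow j n : measurable (low j n).
  by apply: bigcap_measurable => [|t _]; [exists 0%N|exact: mbelow].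
have Plow j n : (P (low j n) <= (M / j.+1%:R)%:E)%E.
  apply: (@le_trans _ _ (P [set w | below j (history n w)])).
    apply: le_measure; rewrite ?inE//.
    by move=> w /(_ 0%N I); rewrite /= addn0.
  rewrite (probability_history n (below j)) lee_fin.
  apply: (le_trans (y := mean n (fun h => j.+1%:R^-1 * (state h astar)^-1))).
    apply: ler_mean => h sh; have q0 := sh.1 astar.
    case: asboolP => [le|_]; last by rewrite mulr_ge0// invr_ge0 ltW.
    by rewrite ler_pdivlMr// mul1r.
  by rewrite meanZ mulrC ler_wpM2r.
have mU j : measurable (\bigcup_n low j n) by exact: bigcupT_measurable.
have PU j : (P (\bigcup_n low j n) <= (M / j.+1%:R)%:E)%E.
  have cv : (P \o low j) n @[n --> \oo] --> P (\bigcup_n low j n).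
    apply: nondecreasing_cvg_mu => //.
    move=> n m nm; apply/subsetPset => w h t _.
    have := h (m - n + t)%N I; by rewrite addnA subnKC.
  rewrite -(cvg_lim _ cv)//; apply: lime_le; first by apply/cvg_ex; eexists; exact: cv.
  by apply: nearW => n; exact: Plow.
exists (\bigcap_j \bigcup_n low j n); split.
- by apply: bigcap_measurable => [|j _]; [exists 0%N|exact: mU].
- apply/eqP; rewrite eq_le measure_ge0 andbT.
  apply/lee_addgt0Pr => e e0; rewrite add0e.
  pose j := truncn (M / e).
  apply: (@le_trans _ _ (P (\bigcup_n low j n))).
    apply: le_measure; rewrite ?inE//.
      by apply: bigcap_measurable => [|j' _]; [exists 0%N|exact: mU].
    by move=> w /(_ j I).
  apply: (le_trans (PU j)); rewrite lee_fin ler_pdivrMr// mulrC -ler_pdivrMr//.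
  by apply/ltW; exact: truncnS_gt.
- move=> w h j _; have [n hn] := h j; exists n => // t _.
  by apply: hn; rewrite leq_addr.
Qed.

Lemma optimal_cvg1 : l x @[x --> 0^'+] --> 0 ->
  {ae P, forall w, samba astar l p0 Rw U V t w astar @[t --> \oo] --> (1 : R)}.
Proof.
move=> l0; pose F (j : nat) := lim_sup_set (undecided j.+1%:R^-1).
have negF : P.-negligible (\bigcup_j F j).
  apply: negligible_bigcup => j; exists (F j); split => //.
    apply: bigcap_measurable => [|n _]; first by exists 0%N.
    by apply: bigcup_measurable => t _; exact: measurable_history_pred.
  by apply: undecided_limsup; rewrite invr_gt0 ltr0Sn/= invf_le1// ler1n.
apply: negligibleS (negligibleU negF (vanishing_negligible l0)).
move=> w ncv; apply: contrapT => /not_orP[nF nV]; apply: ncv.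
rewrite /mkset (_ : (fun t => _) = fun t => state (history t w) astar); last first.
  by apply/funext => t; rewrite samba_history.
apply: (@cvg1_of_dichotomy _ #|A|%:R) => //.
- by rewrite ler1n; apply/card_gt0P; exists astar.
- by move=> t; apply: simplex_itv; exact: simplex_state.
- by move=> t; exact: state_ge.
- move=> j; apply: contrapT => nn; apply: nF; exists j => // n _.
  apply: contrapT => nt; apply: nn; exists n => t nt' h.
  by apply: nt; exists t.
Qed.

(** When the sum of [trailing] is finite it supplies the constant [Q] of the recursion, on which [C]
    may depend; when it is infinite the right side is infinite and any [C] works. *)
Lemma regret_rate : slowly_varying_at0 l ->
  exists C : R, 0 < C /\ forall T : nat, (0 < T)%N -> C / (D * T%:R) <= 1 ->
    ((\sum_(t < T) suboptimality t)%:E <=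
      (C * #|A|%:R / (D * l (C / (D * T%:R))) * ln T%:R)%:E +
      \sum_(t <oo) (trailing t)%:E + 1)%E.
Proof.
move=> lsv; set Q := (\sum_(t <oo) _)%E.
have Q0 : (0 <= Q)%E by apply: nneseries_ge0 => t _ _; rewrite lee_fin trailing_ge0.
have N1 : 1 <= #|A|%:R :> R by rewrite ler1n; apply/card_gt0P; exists astar.
have [Qfin|Qoo] := boolP (Q \is a fin_num); last first.
  exists 1; split => // T _ _.
  have -> : Q = +oo%E by apply/eqP; move: Qoo; rewrite ge0_fin_numE// -leNgt leye_eq.
  by rewrite addey// addye// leey.
have eQ n : \sum_(t < n) trailing t <= fine Q.
  rewrite -lee_fin fineK// -sumEFin -(big_mkord xpredT (fun t => (trailing t)%:E)).
  by apply: nneseries_lim_ge => t _ _; rewrite lee_fin trailing_ge0.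
have [K K0 hK] := sum_rate lr lpos D0 N1 suboptimality_itv suboptimality_nonincreasing
  trailing_ge0 eQ suboptimality_drift.
have [C [C0 hC]] := rate_constant lr lsv D0 N1 K0.
exists C; split => // T T0 CT; have [T2 le] := hC T T0 CT.
rewrite -(fineK Qfin) -!EFinD lee_fin.
apply: (le_trans (hK T T2)); have : 0 <= fine Q by exact: fine_ge0.
lra.
Qed.

End Drift.
End History.

Theorem theorem4 (R : realType) (A : finType) (d : measure_display)
  (Omega : measurableType d) (P : probability Omega R)
  (l : R -> R) (r : A -> R) (astar : A) (p0 : A -> R)
  (Rw : A -> nat -> Omega -> R) (U V : nat -> Omega -> R) :
  (* l : [0,1] -> [0,1], monotone increasing, slowly varying at 0, l(0+) = 0 *)
  (forall x, 0 <= x <= 1 -> 0 <= l x <= 1) ->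
  {in [set x : R | 0 <= x <= 1] &, nondecreasing l} ->
  slowly_varying_at0 l ->
  l x @[x --> 0^'+] --> 0 ->
  (* bandit model *)
  (forall a, 0 <= r a <= 1) ->
  (forall a, a != astar -> r a < r astar) ->
  (forall a t, bernoulli_rv P (Rw a t) (r a)) ->
  (forall t, uniform01 P (U t)) ->
  (forall t, uniform01 P (V t)) ->
  mutual_indep P (fun i : (A * nat + nat) + nat =>
    match i with
    | inl (inl (a, t)) => Rw a t
    | inl (inr t) => U t
    | inr t => V t
    end) ->
  (* initial probability vector with positive entries *)
  (forall a, 0 < p0 a) -> \sum_a p0 a = 1 ->
  let Delta := r astar - \big[Num.max/0]_(a | a != astar) r a in
  let p := samba astar l p0 Rw U V in
  let arm t w := played astar (p t w) (U t w) in
  let Rg (T : nat) : \bar R :=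
    ((r astar * T%:R)%:E -
     'E_P[fun w => (\sum_(t < T) \sum_a (arm t w == a)%:R * Rw a t w)%R])%E in
  let Q : \bar R := (\sum_(t <oo) P [set w | (p t w astar <= 2^-1)%R])%E in
  markov_chain P p /\
  {ae P, forall w, p t w astar @[t --> \oo] --> (1 : R)} /\
  exists C : R, 0 < C /\
    forall T : nat, (0 < T)%N -> C / (Delta * T%:R) <= 1 ->
      (Rg T <= (C * #|A|%:R / (Delta * l (C / (Delta * T%:R))) * ln T%:R)%:E
               + Q + 1)%E.

Proof.
move=> l01 lnd lsv l0 r01 rlt rwB unifU unifV indep p0pos p0sum Delta p arm Rg Q.
have lr : unit_rate l.
  split=> // x y x0 xy y1; apply: lnd => //; rewrite inE/=.
    by rewrite x0 (le_trans xy).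
  by rewrite y1 (le_trans x0).
have p0s : simplex p0 by [].
split; first exact: (markov_samba astar lr p0s rwB indep).
have QE : Q = (\sum_(t <oo) (trailing P l astar p0 Rw U V t)%:E)%E.
  apply: eq_eseriesr => t _.
  pose S h : Prop := state l p0 h astar <= 2^-1.
  rewrite (_ : [set w | _] = [set w | S (history l astar p0 Rw U V t w)]); last first.
    apply/seteqP; split => w; rewrite /S /mkset /p.
      by rewrite (samba_history l astar p0 U V rwB).
    by rewrite (samba_history l astar p0 U V rwB).
  rewrite (probability_history l astar p0 indep t S) /trailing; congr EFin.
  by apply: eq_bigr => h _; rewrite asboolb.
(* With a single arm the maximum in [Delta] takes its default value 0, so [Delta] equals [r astar]
   and may vanish. The state is then constantly 1 at [astar], the suboptimality is 0, and the right
   side is nonnegative. *)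
have [alone|[b bn]] : (forall a, a = astar) \/ (exists b, b != astar).
  have [h|h] := pselect (exists b, b != astar); [by right|left => a].
  by apply/eqP/negPn/negP => an; apply: h; exists a.
- have one (q : A -> R) : simplex q -> q astar = 1.
    move=> [_ <-]; rewrite (bigD1 astar)//= big1 ?addr0// => a.
    by rewrite (alone a) eqxx.
  split.
    apply: aeW => w; rewrite (_ : (fun t => _) = cst 1); first exact: cvg_cst.
    apply/funext => t; rewrite /p (samba_history l astar p0 U V rwB).
    by apply: one; exact: simplex_state.
  exists 1; split => // T T0 CT.
  apply: (le_trans (regret_le astar lr p0s rwB unifU indep T r01)).
  rewrite big1 => [|t _]; last first.
    rewrite /suboptimality -[RHS](mean_cst l astar p0 indep t).
    by apply: eq_mean => // h sh; rewrite (one _ sh) subrr.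
  have Delta0 : 0 <= Delta.
    rewrite /Delta big_pred0 ?subr0; last by move=> a; rewrite (alone a) eqxx.
    by case/andP: (r01 astar).
  have /andP[lC0 _] : 0 <= l (1 / (Delta * T%:R)) <= 1.
    by apply: l01; rewrite CT andbT divr_ge0// mulr_ge0.
  rewrite !adde_ge0// ?nneseries_ge0// lee_fin.
  by rewrite mulr_ge0 ?ln_ge0 ?ler1n// divr_ge0// ?mulr_ge0.
(* The default 0 also enters the maximum when other arms exist, so positivity of [Delta] requires
   [r astar] to exceed 0 as well as every other mean. *)
- have rpos : 0 < r astar.
    by apply: le_lt_trans (rlt b bn); case/andP: (r01 b).
  have Delta0 : 0 < Delta.
    rewrite subr_gt0; apply: (big_ind (fun x => x < r astar)) => //.
    by move=> x y hx hy; rewrite gt_max hx.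
  have Dr a : a != astar -> Delta <= r astar - r a.
    by move=> an; rewrite lerD2l lerN2; exact: (le_bigmax_cond 0 r an).
  split.
    exact: (optimal_cvg1 lr p0s rwB unifU indep r01 Delta0 Dr lsv.1 l0).
  have [C [C0 hC]] := regret_rate lr p0s rwB unifU indep Delta0 Dr lsv.1 lsv.
  exists C; split => // T T0 CT; rewrite QE.
  apply: le_trans (hC T T0 CT).
  exact: (regret_le astar lr p0s rwB unifU indep T r01).
Qed.
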